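(* Let $(\Omega,\Sigma,\mu)$ be a complete finite measure space and let $(\mathcal H,L)$ be a measurable bundle of complex Hilbert spaces over $\Omega$. Let $\{k_j\}_{j\ge1}$ be a strictly increasing sequence of positive integers satisfying $$\lim_{n\to\infty}\frac1n\sum_{j=1}^n\lambda^{k_j}=0\quad\text{for every }\lambda\in\mathbb C\text{ with }|\lambda|=1,\ \lambda\ne1.$$ Then for a given contraction $T$ in $L^0(\Omega,\mathcal H)$, the subsequential average $$A_n(k_j,T,\hat u)=\frac1n\sum_{j=1}^{n}T^{k_j}\hat u$$ converges in norm as $n\to\infty$ for all $\hat u\in L^0(\Omega,\mathcal H)$.
   Context: $L^0=L^0(\Omega)$ is the algebra of a.e.-equivalence classes of complex measurable functions on $\Omega$; order relations between real elements of $L^0$ are a.e., and $\mathbf 1\in L^0$ is the class of the constant function $1$. Measurable bundle of Hilbert spaces: $\mathcal H$ assigns to each $\omega\in\Omega$ a complex Hilbert space $\mathcal H(\omega)$. A section is a function $u$ defined a.e. on $\Omega$, with domain $\mathrm{dom}(u)$, such that $u(\omega)\in\mathcal H(\omega)$ for $\omega\in\mathrm{dom}(u)$. For a set $L$ of sections, $(\mathcal H,L)$ is a measurable bundle if (1) $\lambda_1c_1+\lambda_2c_2\in L$ for all $\lambda_1,\lambda_2\in\mathbb C$, $c_1,c_2\in L$, where this section is defined pointwise on $\mathrm{dom}(c_1)\cap\mathrm{dom}(c_2)$; (2) $\omega\mapsto\|c(\omega)\|_{\mathcal H(\omega)}$ is measurable for all $c\in L$; (3) for every $\omega\in\Omega$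 the set $\{c(\omega):c\in L,\ \omega\in\mathrm{dom}(c)\}$ is dense in $\mathcal H(\omega)$. A step-section is $s(\omega)=\sum_{i=1}^n\chi_{A_i}(\omega)c_i(\omega)$ with $c_i\in L$, $A_i\in\Sigma$. A section $u$ is measurable if there are step-sections $s_n$ with $\|s_n(\omega)-u(\omega)\|_{\mathcal H(\omega)}\to0$ for almost all $\omega$. $M(\Omega,\mathcal H)$ is the set of measurable sections, and $L^0(\Omega,\mathcal H)$ is its quotient by a.e. equality; $\hat u$ is the class of $u$. $L^0(\Omega,\mathcal H)$ is an $L^0$-module under pointwise operations, with $L^0$-valued norm $\|\hat u\|$ = the class of $\omega\mapsto\|u(\omega)\|_{\mathcal H(\omega)}$; with the pointwise inner product it is a Hilbert–Kaplansky space over $L^0$ (and every Hilbert–Kaplansky space over $L^0$ is isometrically isomorphic to one of this form). An operator $T:L^0(\Omega,\mathcal H)\to L^0(\Omega,\mathcal H)$ is $L^0$-linear if $T(\alpha x+\beta y)=\alpha T(x)+\beta T(y)$ for all $\alpha,\beta\in L^0$ and all $x,y$; an $L^0$-linear $T$ is $L^0$-bounded if it maps bounded sets (sets $B$ with $\{\|x\|:x\in B\}$ order bounded in $L^0$) to bounded sets. Its norm is $\|T\|=\sup\{\|Tx\|:\|x\|\le\mathbf 1\}\in L^0$. A contraction in $L^0(\Omega,\mathcal H)$ is an $L^0$-linear, $L^0$-bounded operator with $\|T\|\le\mathbf 1$. A sequence $x_n$ in $L^0(\Omega,\mathcal H)$ converges in norm if there is $x\in L^0(\Omega,\mathcal H)$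 such that $\|x_n-x\|$ order converges to $0$ in $L^0$, equivalently $\|x_n(\omega)-x(\omega)\|_{\mathcal H(\omega)}\to0$ for almost all $\omega$. *)

(* Defs.v *)
From HB Require Import structures.
From mathcomp Require Import all_boot all_order all_algebra complex sesquilinear.
From mathcomp Require Import all_classical all_reals all_analysis.
From mathcomp Require Import measurable_realfun.

Set Implicit Arguments.
Unset Strict Implicit.
Unset Printing Implicit Defensive.

Import Order.TTheory GRing.Theory Num.Theory numFieldNormedType.Exports HBSimple.

Local Open Scope classical_set_scope.
Local Open Scope ring_scope.
Local Open Scope quotient_scope.

(* Norms of complex normed spaces are valued in R[i], with the partial order
   x <= y iff Im x = Im y and Re x <= Re y; in particular `|x| is real. *)
HB.mixin Record isHilbert (R : realType) H of CompleteNormedModule R[i] H := {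
  inner : {dot H for @Num.conj R[i]} ;
  sqr_norm_inner : forall x : H, `|x| ^+ 2 = inner x x
}.

#[short(type="hilbertType")]
HB.structure Definition Hilbert (R : realType) :=
  {H of isHilbert R H & CompleteNormedModule R[i] H}.

Section L0.
Context (R : realType) (d : measure_display) (Omega : measurableType d).
Variable mu : {measure set Omega -> \bar R}.
Local Notation C := R[i].

Definition cmeasurable (f : Omega -> C) :=
  measurable_fun setT (fun w => complex.Re (f w)) /\
  measurable_fun setT (fun w => complex.Im (f w)).

Record cmfun := CMfun { cmfun_val :> Omega -> C ; cmfunP : cmeasurable cmfun_val }.

HB.instance Definition _ := gen_eqMixin cmfun.
HB.instance Definition _ := gen_choiceMixin cmfun.

Definition cmfun_eq (f g : cmfun) := `[< \forall w \ae mu, f w = g w >].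

Let cmfun_eq_refl : reflexive cmfun_eq.
Proof. by move=> f; apply/asboolP; apply: aeW. Qed.

Let cmfun_eq_sym : symmetric cmfun_eq.
Proof.
by move=> f g; apply/asboolP/asboolP; apply: filterS => w ->.
Qed.

Let cmfun_eq_trans : transitive cmfun_eq.
Proof.
move=> g f h /asboolP fg /asboolP gh; apply/asboolP.
by apply: filterS2 fg gh => w -> ->.
Qed.

Canonical cmfun_eq_equiv :=
  EquivRel cmfun_eq cmfun_eq_refl cmfun_eq_sym cmfun_eq_trans.

Definition L0 : Type := {eq_quot cmfun_eq}.
HB.instance Definition _ := Choice.on L0.
HB.instance Definition _ := EqQuotient.on L0.
Definition L0_fun (f : L0) : Omega -> C := repr f.
Coercion L0_fun : L0 >-> Funclass.

Definition L0_of (f : cmfun) : L0 := \pi_L0 f.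

Lemma L0_ofE (f : cmfun) : \forall w \ae mu, L0_of f w = f w.
Proof.
have /eqmodP/asboolP : L0_of (repr (L0_of f)) = L0_of f by rewrite /L0_of reprK.
exact.
Qed.

Lemma L0P (x y : L0) : (\forall w \ae mu, x w = y w) -> x = y.
Proof.
move=> xy; rewrite -[x]reprK -[y]reprK; apply/eqmodP; exact/asboolP.
Qed.

Lemma cmeasurable_cst (c : C) : cmeasurable (fun=> c).
Proof. by split; exact: measurable_cst. Qed.

Lemma cmeasurableD (f g : Omega -> C) :
  cmeasurable f -> cmeasurable g -> cmeasurable (fun w => f w + g w).
Proof.
move=> [fr fi] [gr gi]; split.
  rewrite (_ : (fun _ => _) = (fun w => complex.Re (f w)) \+
    (fun w => complex.Re (g w))); first exact: measurable_funD.
  by apply/funext => w /=; case: (f w); case: (g w).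
rewrite (_ : (fun _ => _) = (fun w => complex.Im (f w)) \+
  (fun w => complex.Im (g w))); first exact: measurable_funD.
by apply/funext => w /=; case: (f w); case: (g w).
Qed.

Lemma cmeasurableM (f g : Omega -> C) :
  cmeasurable f -> cmeasurable g -> cmeasurable (fun w => f w * g w).
Proof.
move=> [fr fi] [gr gi]; split.
  rewrite (_ : (fun _ => _) =
    ((fun w => complex.Re (f w)) \* (fun w => complex.Re (g w))) \-
    ((fun w => complex.Im (f w)) \* (fun w => complex.Im (g w)))).
    by apply: measurable_funB; apply: measurable_funM.
  by apply/funext => w /=; case: (f w); case: (g w).
rewrite (_ : (fun _ => _) =
    ((fun w => complex.Re (f w)) \* (fun w => complex.Im (g w))) \+
    ((fun w => complex.Im (f w)) \* (fun w => complex.Re (g w)))).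
  by apply: measurable_funD; apply: measurable_funM.
by apply/funext => w /=; case: (f w); case: (g w).
Qed.

Lemma cmeasurableN (f : Omega -> C) :
  cmeasurable f -> cmeasurable (fun w => - f w).
Proof.
move=> mf; rewrite (_ : (fun _ => _) = (fun w => -1 * f w)).
  exact: cmeasurableM (cmeasurable_cst _) mf.
by apply/funext => w; rewrite mulN1r.
Qed.

Definition L0_cst (c : C) : L0 := L0_of (CMfun (cmeasurable_cst c)).
Definition L0_opp (f : L0) : L0 := L0_of (CMfun (cmeasurableN (cmfunP (repr f)))).
Definition L0_add (f g : L0) : L0 :=
  L0_of (CMfun (cmeasurableD (cmfunP (repr f)) (cmfunP (repr g)))).
Definition L0_mul (f g : L0) : L0 :=
  L0_of (CMfun (cmeasurableM (cmfunP (repr f)) (cmfunP (repr g)))).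

Lemma L0_cstE c : \forall w \ae mu, L0_cst c w = c.
Proof. exact: L0_ofE. Qed.
Lemma L0_oppE f : \forall w \ae mu, L0_opp f w = - f w.
Proof. exact: L0_ofE. Qed.
Lemma L0_addE f g : \forall w \ae mu, L0_add f g w = f w + g w.
Proof. exact: L0_ofE. Qed.
Lemma L0_mulE f g : \forall w \ae mu, L0_mul f g w = f w * g w.
Proof. exact: L0_ofE. Qed.

Local Ltac L0near := apply: L0P; near=> w.

Let L0_addA : associative L0_add.
Proof.
move=> f g h; L0near.
rewrite (near (L0_addE f (L0_add g h)) w)// (near (L0_addE g h) w)//.
rewrite (near (L0_addE (L0_add f g) h) w)// (near (L0_addE f g) w)//.
exact: addrA.
Unshelve. all: by end_near. Qed.

Let L0_addC : commutative L0_add.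
Proof.
move=> f g; L0near.
by rewrite (near (L0_addE f g) w)// (near (L0_addE g f) w)// addrC.
Unshelve. all: by end_near. Qed.

Let L0_add0 : left_id (L0_cst 0) L0_add.
Proof.
move=> f; L0near.
by rewrite (near (L0_addE (L0_cst 0) f) w)// (near (L0_cstE 0) w)// add0r.
Unshelve. all: by end_near. Qed.

Let L0_addN : left_inverse (L0_cst 0) L0_opp L0_add.
Proof.
move=> f; L0near.
rewrite (near (L0_addE (L0_opp f) f) w)// (near (L0_oppE f) w)//.
by rewrite (near (L0_cstE 0) w)// addNr.
Unshelve. all: by end_near. Qed.

HB.instance Definition _ :=
  GRing.isZmodule.Build L0 L0_addA L0_addC L0_add0 L0_addN.

Let L0_mulA : associative L0_mul.
Proof.
move=> f g h; L0near.
rewrite (near (L0_mulE f (L0_mul g h)) w)// (near (L0_mulE g h) w)//.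
rewrite (near (L0_mulE (L0_mul f g) h) w)// (near (L0_mulE f g) w)//.
exact: mulrA.
Unshelve. all: by end_near. Qed.

Let L0_mulC : commutative L0_mul.
Proof.
move=> f g; L0near.
by rewrite (near (L0_mulE f g) w)// (near (L0_mulE g f) w)// mulrC.
Unshelve. all: by end_near. Qed.

Let L0_mul1 : left_id (L0_cst 1) L0_mul.
Proof.
move=> f; L0near.
by rewrite (near (L0_mulE (L0_cst 1) f) w)// (near (L0_cstE 1) w)// mul1r.
Unshelve. all: by end_near. Qed.

Let L0_mulDl : left_distributive L0_mul L0_add.
Proof.
move=> f g h; L0near.
rewrite (near (L0_mulE (L0_add f g) h) w)// (near (L0_addE f g) w)//.
rewrite (near (L0_addE (L0_mul f h) (L0_mul g h)) w)//.
by rewrite (near (L0_mulE f h) w)// (near (L0_mulE g h) w)// mulrDl.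
Unshelve. all: by end_near. Qed.

HB.instance Definition _ :=
  GRing.Zmodule_isComPzRing.Build L0 L0_mulA L0_mulC L0_mul1 L0_mulDl.

(* The order of R[i] compares only elements with the same imaginary part: on
   real elements this is the a.e. order, and any upper or lower bound of a
   nonempty set of real elements is real. *)
Definition L0_le (f g : L0) := `[< \forall w \ae mu, f w <= g w >].

Let L0_le_refl : reflexive L0_le.
Proof. by move=> f; apply/asboolP; apply: aeW. Qed.

Let L0_le_anti : antisymmetric L0_le.
Proof.
move=> f g /andP[/asboolP fg /asboolP gf]; apply: L0P.
by apply: filterS2 fg gf => w fg gf; apply/eqP; rewrite eq_le fg.
Qed.

Let L0_le_trans : transitive L0_le.
Proof.
move=> g f h /asboolP fg /asboolP gh; apply/asboolP.
by apply: filterS2 fg gh => w; exact: le_trans.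
Qed.

HB.instance Definition _ := Order.Le_isPOrder.Build ring_display L0
  L0_le_refl L0_le_anti L0_le_trans.

Lemma L0_leP (f g : L0) : reflect (\forall w \ae mu, f w <= g w) (f <= g).
Proof. exact: asboolP. Qed.

(* Order convergence, for sequences of real elements. *)
Definition L0_ocvg (f : nat -> L0) (l : L0) :=
  exists y : nat -> L0, [/\ nonincreasing_seq y, infimums (range y) 0 &
    forall n, - y n <= f n - l <= y n].

Definition L0_order_bounded (S : set L0) := has_ubound S /\ has_lbound S.

End L0.

Section sections.
Context (R : realType) (d : measure_display) (Omega : measurableType d).
Variables (mu : {measure set Omega -> \bar R}) (H : Omega -> hilbertType R).
Local Notation C := R[i].

(* A partially defined function; None means undefined. *)
Record bsection := BSection {
  bsec :> forall w, option (H w) ;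
  bsec_ae : \forall w \ae mu, bsec w
}.

Definition bdom (u : bsection) : set Omega := [set w | u w].

(* The value is only meaningful on bdom u. *)
Definition bval (u : bsection) (w : Omega) : H w := odflt 0 (u w).

Program Definition brestrict (D : set Omega) (aeD : \forall w \ae mu, D w)
    (f : forall w, H w) : bsection :=
  @BSection (fun w => if pselect (D w) then Some (f w) else None) _.
Next Obligation.
move=> D aeD f; apply: filterS aeD => w Dw.
by case: pselect.
Qed.

Lemma bdom_restrict D aeD f : bdom (@brestrict D aeD f) = D.
Proof.
by apply/seteqP; split=> w; rewrite /bdom /=; case: pselect.
Qed.

Lemma bval_restrict D aeD f w : D w -> bval (@brestrict D aeD f) w = f w.
Proof. by rewrite /bval /=; case: pselect. Qed.

Lemma bdomI_ae (u v : bsection) : \forall w \ae mu, (bdom u `&` bdom v) w.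
Proof. by apply: filterS2 (bsec_ae u) (bsec_ae v) => w. Qed.

Definition blincomb (a : C) (u : bsection) (b : C) (v : bsection) : bsection :=
  brestrict (bdomI_ae u v) (fun w => a *: bval u w + b *: bval v w).

Lemma bdom_bigcap_ae n (c : 'I_n -> bsection) :
  \forall w \ae mu, (\bigcap_(i in setT) bdom (c i)) w.
Proof.
have : \forall w \ae mu, forall i : 'I_n, bdom (c i) w.
  by apply: filter_forall => i; exact: bsec_ae.
by apply: filterS => w h i _; exact: h.
Qed.

Definition bstep n (A : 'I_n -> set Omega) (c : 'I_n -> bsection) : bsection :=
  brestrict (bdom_bigcap_ae c)
    (fun w => \sum_(i < n) (\1_(A i) w : C) *: bval (c i) w).

Record is_mbundle (L : set bsection) : Prop := {
  mbundle_lin : forall (a b : C) u v, L u -> L v -> L (blincomb a u b v) ;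
  mbundle_norm : forall u, L u ->
    measurable_fun (bdom u) (fun w => complex.Re `|bval u w|) ;
  mbundle_dense : forall w, dense [set x : H w | exists2 u, L u & u w = Some x]
}.

Definition is_step (L : set bsection) (s : bsection) :=
  exists n (A : 'I_n -> set Omega) (c : 'I_n -> bsection),
    [/\ forall i, measurable (A i), forall i, L (c i) & s = bstep A c].

Definition bmeasurable (L : set bsection) (u : bsection) :=
  exists2 s : nat -> bsection, forall n, is_step L (s n) &
    \forall w \ae mu, (fun n => bval (s n) w) @ \oo --> bval u w.

(* Total functions a.e. equal to a step-section, resp. to a measurable one. *)
Variable L : set bsection.
Hypothesis bL : is_mbundle L.

Definition tstep (v : forall w, H w) :=
  exists2 s, is_step L s & \forall w \ae mu, bval s w = v w.

Definition tmeas (v : forall w, H w) :=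
  exists2 s : nat -> forall w, H w, forall n, tstep (s n) &
    \forall w \ae mu, (fun n => s n w) @ \oo --> v w.

Lemma tmeas_bmeasurable u : bmeasurable L u -> tmeas (bval u).
Proof.
move=> [s ss su]; exists (fun n => bval (s n)) => // n.
by exists (s n) => //; exact: aeW.
Qed.

Lemma bmeasurable_tmeas u v : (\forall w \ae mu, bval u w = v w) ->
  tmeas v -> bmeasurable L u.
Proof.
move=> uv [s /(_ _)/cid2-/all_sig2[t ts st] sv]; exists t => //.
have /ae_foralln st' := st.
near=> w; rewrite (near uv w)//.
rewrite (_ : (fun n => _) = (fun n => s n w)); last first.
  by apply/funext => n; exact: (near st' w).
exact: (near sv w).
Unshelve. all: by end_near. Qed.

Lemma tstep_ae u v : (\forall w \ae mu, u w = v w) -> tstep u -> tstep v.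
Proof.
by move=> uv [s ss su]; exists s => //; apply: filterS2 su uv => w -> ->.
Qed.

Lemma tmeas_ae u v : (\forall w \ae mu, u w = v w) -> tmeas u -> tmeas v.
Proof.
move=> uv [s ss su]; exists s => //.
by apply: filterS2 su uv => w + <-.
Qed.

Lemma bval_bstep n (A : 'I_n -> set Omega) c : \forall w \ae mu,
  bval (bstep A c) w = \sum_(i < n) (\1_(A i) w : C) *: bval (c i) w.
Proof.
by apply: filterS (bdom_bigcap_ae c) => w Dw; rewrite bval_restrict.
Qed.

Lemma bval_blincomb a u b v : \forall w \ae mu,
  bval (blincomb a u b v) w = a *: bval u w + b *: bval v w.
Proof.
by apply: filterS (bdomI_ae u v) => w Dw; rewrite bval_restrict.
Qed.

Lemma tstepP v : tstep v <-> exists n (A : 'I_n -> set Omega) (c : 'I_n -> bsection),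
  [/\ forall i, measurable (A i), forall i, L (c i) &
   \forall w \ae mu, v w = \sum_(i < n) (\1_(A i) w : C) *: bval (c i) w].
Proof.
split=> [[_ [n [A [c [mA Lc ->]]]] vE]|[n [A [c [mA Lc vE]]]]].
  exists n, A, c; split => //.
  by apply: filterS2 (bval_bstep A c) vE => w -> ->.
exists (bstep A c); first by exists n, A, c.
by apply: filterS2 (bval_bstep A c) vE => w -> ->.
Qed.

Lemma tstep0 : tstep (fun=> 0).
Proof.
apply/tstepP; exists 0, (fun=> set0), (ffun0 (card_ord 0)).
split=> [[]//|[]//|].
by apply: aeW => w; rewrite big_ord0.
Qed.

Lemma tstepD u v : tstep u -> tstep v -> tstep (fun w => u w + v w).
Proof.
move=> /tstepP[n [A [c [mA Lc uE]]]] /tstepP[m [B [e [mB Le vE]]]].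
apply/tstepP; exists (n + m)%N.
exists (fun i => match fintype.split i with inl j => A j | inr j => B j end).
exists (fun i => match fintype.split i with inl j => c j | inr j => e j end).
split=> [i|i|]; [by case: fintype.split|by case: fintype.split|].
apply: filterS2 uE vE => w -> ->; rewrite big_split_ord/=; congr (_ + _).
  apply: eq_bigr => i _; case: fintype.splitP => j /= ij.
    by rewrite (_ : i = j)//; exact/val_inj.
  by move: (ltn_ord i); rewrite ij ltnNge leq_addr.
apply: eq_bigr => i _; case: fintype.splitP => j /= ij.
  by move: (ltn_ord j); rewrite -ij ltnNge leq_addr.
by rewrite (_ : i = j)//; apply/val_inj; apply: (@addnI n).
Qed.

Lemma tstepZ a B v : measurable B -> tstep v ->
  tstep (fun w => (a * \1_B w : C) *: v w).
Proof.
move=> mB /tstepP[n [A [c [mA Lc uE]]]]; apply/tstepP.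
exists n, (fun i => B `&` A i), (fun i => blincomb a (c i) 0 (c i)).
split=> [i|i|]; [exact: measurableI|exact: (mbundle_lin bL)|].
have cE : \forall w \ae mu, forall i,
    bval (blincomb a (c i) 0 (c i)) w = a *: bval (c i) w + 0 *: bval (c i) w.
  by apply: filter_forall => i; exact: bval_blincomb.
apply: filterS2 uE cE => w -> cE; rewrite scaler_sumr; apply: eq_bigr => i _.
rewrite cE scale0r addr0 !scalerA indicI /=; congr (_ *: _).
by rewrite -mulrA mulrC.
Qed.

Lemma tstep_sum (I : Type) (r : seq I) (F : I -> forall w, H w) :
  (forall i, tstep (F i)) -> tstep (fun w => \sum_(i <- r) F i w).
Proof.
move=> sF; elim: r => [|i r ih].
  by apply: tstep_ae tstep0; apply: aeW => w; rewrite big_nil.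
by apply: tstep_ae (tstepD (sF i) ih); apply: aeW => w; rewrite big_cons.
Qed.

Lemma tmeas0 : tmeas (fun=> 0).
Proof.
exists (fun _ _ => 0); first by move=> _; exact: tstep0.
by apply: aeW => w; exact: cvg_cst.
Qed.

Lemma tmeasD u v : tmeas u -> tmeas v -> tmeas (fun w => u w + v w).
Proof.
move=> [s ss su] [t tt tv]; exists (fun n w => s n w + t n w).
  by move=> n; exact: tstepD.
by apply: filterS2 su tv => w su tv; exact: cvgD.
Qed.

Lemma tmeasZ a v : tmeas v -> tmeas (fun w => a *: v w).
Proof.
move=> [s ss su]; exists (fun n w => a *: s n w).
  move=> n; apply: tstep_ae (tstepZ a measurableT (ss n)).
  by apply: aeW => w; rewrite indicT mulr1.
by apply: filterS su => w su; exact: cvgZr.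
Qed.

Lemma complex_cvg (g : nat -> R) (l : R) : g @ \oo --> l ->
  (fun n => (g n)%:C%C : C^o) @ \oo --> (l%:C%C : C^o).
Proof.
move=> /cvgrPdist_lt gl; apply/cvgrPdist_lt => e e0.
have : 0 < complex.Re e by move: e0; rewrite ltcE => /andP[].
move=> /gl; apply: filterS => n.
rewrite -rmorphB /= normc_def /= expr0n addr0 sqrtr_sqr => h.
by move: e0; rewrite !ltcE /= => /andP[-> _].
Qed.

Lemma tmeas_scale_real (g : Omega -> R) v : measurable_fun setT g -> tmeas v ->
  tmeas (fun w => (g w)%:C%C *: v w).
Proof.
move=> mg [s ss sv].
have [f fg] := approximation_sfun measurableT (proj2 (measurable_EFinP setT g) mg).
exists (fun n w => (f n w)%:C%C *: s n w).
  move=> n /=; pose r := finmap.enum_fset (fset_set (range (f n))).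
  apply: (@tstep_ae (fun w => \sum_(i < size r)
      (((r`_i)%:C%C * \1_(f n @^-1` [set r`_i]) w : C) *: s n w))); last first.
    by apply: tstep_sum => i; apply: tstepZ.
  apply: aeW => w; rewrite -scaler_suml; congr (_ *: _).
  rewrite (fimfunEord (f n) w) rmorph_sum/=; apply: eq_bigr => i _.
  by rewrite rmorphM/= !indicE; case: (_ \in _).
apply: filterS sv => w sv.
have : f ^~ w @ \oo --> g w.
  have /fine_cvgP[_] := fg w I.
  exact.
move=> /complex_cvg fgw.
exact: (@cvgZ C (H w)).
Qed.

Lemma tmeas_scale (g : Omega -> C) v : cmeasurable g -> tmeas v ->
  tmeas (fun w => g w *: v w).
Proof.
move=> [mr mi] mv.
have := tmeasD (tmeas_scale_real mr mv)
               (tmeasZ 'i%C (tmeas_scale_real mi mv)).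
by apply: tmeas_ae; apply: aeW => w; rewrite scalerA -scalerDl -complexE.
Qed.

Hypothesis cmu : measure_is_complete mu.

Lemma ae_measurable (f g : Omega -> R) : (\forall w \ae mu, f w = g w) ->
  measurable_fun setT f -> measurable_fun setT g.
Proof.
move=> fg mf; apply/measurable_EFinP.
apply: (@ae_measurable_fun _ _ _ _ cmu setT (EFin \o f)).
  by apply: filterS fg => w /= ->.
exact/measurable_EFinP.
Qed.

Let nmeas (v : forall w, H w) :=
  measurable_fun setT (fun w => complex.Re `|v w|).

Let nmeas_ae u v : (\forall w \ae mu, u w = v w) -> nmeas u -> nmeas v.
Proof. by move=> uv; apply: ae_measurable; apply: filterS uv => w ->. Qed.

Let nmeasL u : L u -> nmeas (bval u).
Proof.
move=> Lu; have mD : measurable (bdom u).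
  rewrite -[bdom u]setCK; apply: measurableC; apply: cmu.
  exact: bsec_ae.
rewrite /nmeas -[X in measurable_fun X _](setUv (bdom u)).
apply/(measurable_funU _ mD (measurableC mD)); split.
  exact: (mbundle_norm bL Lu).
apply: (@eq_measurable_fun _ _ _ _ _ (cst (0 : R))); last exact: measurable_cst.
move=> w; rewrite inE /bdom /bval /= => uw.
by case: (u w) uw => //= _; rewrite normr0.
Qed.

Let nmeas_step n (A : 'I_n -> set Omega) (c : 'I_n -> bsection) e :
  (forall i, measurable (A i)) -> (forall i, L (c i)) -> L e ->
  nmeas (fun w => \sum_(i < n) (\1_(A i) w : C) *: bval (c i) w + bval e w).
Proof.
elim: n A c e => [|n ih] A c e mA Lc Le.
  apply: nmeas_ae (nmeasL Le); apply: aeW => w.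
  by rewrite big_ord0 add0r.
pose A' i := A (widen_ord (leqnSn n) i).
pose c' i := c (widen_ord (leqnSn n) i).
pose e1 := blincomb 1 (c ord_max) 1 e.
have Le1 : L e1 by exact: (mbundle_lin bL).
have m0 : nmeas _ := ih A' c' e (fun=> mA _) (fun=> Lc _) Le.
have m1 : nmeas _ := ih A' c' e1 (fun=> mA _) (fun=> Lc _) Le1.
have mb : measurable_fun setT (fun w => w \in A ord_max).
  apply: (measurable_fun_bool true); rewrite setTI.
  rewrite (_ : _ @^-1` _ = A ord_max)//.
  by apply/seteqP; split=> w /=; [exact: set_mem|exact: mem_set].
apply: ae_measurable (measurable_fun_ifT mb m1 m0).
apply: filterS (bval_blincomb 1 (c ord_max) 1 e) => w /= e1E.
rewrite big_ord_recr/= indicE; case: ifPn => _.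
  by rewrite e1E !scale1r addrA.
by rewrite scale0r addr0.
Qed.

Let nmeas_tstep v : tstep v -> nmeas v.
Proof.
move=> /tstepP[[|n] [A [c [mA Lc vE]]]].
  apply: (@nmeas_ae (fun=> 0)).
    by apply: filterS vE => w ->; rewrite big_ord0.
  by apply: (@eq_measurable_fun _ _ _ _ _ (cst (0 : R))) => [w _|];
    [rewrite normr0|exact: measurable_cst].
pose e := blincomb 0 (c ord0) 0 (c ord0).
have Le : L e by exact: (mbundle_lin bL).
apply: nmeas_ae (nmeas_step mA Lc Le).
apply: filterS2 vE (bval_blincomb 0 (c ord0) 0 (c ord0)) => w -> ->.
by rewrite !scale0r !addr0.
Qed.

Lemma tmeas_norm v : tmeas v -> cmeasurable (fun w => `|v w|).
Proof.
move=> [s ss sv]; split; last first.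
  apply: (@eq_measurable_fun _ _ _ _ _ (cst (0 : R))); last exact: measurable_cst.
  by move=> w _; rewrite ger0_Im.
have [N [mN N0 subN]] := sv.
pose f n w := complex.Re `|s n w| * \1_(~` N) w.
have mf n : measurable_fun setT (f n).
  apply: measurable_funM; first exact: nmeas_tstep.
  by apply: measurable_indic; exact: measurableC.
apply: (@ae_measurable (fun w => complex.Re `|v w| * \1_(~` N) w)).
  exists N; split => // w /= h; apply: contrapT => Nw; apply: h.
  by rewrite indicE mem_set// mulr1.
apply: (measurable_realfun.measurable_fun_cvg mf) => w _; rewrite /f indicE.
have [wN|wN] := boolP (w \in ~` N); last first.
  rewrite /= mulr0; under eq_fun do rewrite mulr0; exact: cvg_cst.
rewrite /= mulr1; under eq_fun do rewrite mulr1.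
have {}sv : s n w @[n --> \oo] --> v w.
  apply: contrapT => h; move: wN; rewrite inE; apply; exact: subN.
apply/cvgrPdist_lt => e e0.
have /cvgrPdist_lt/(_ e%:C%C) := sv.
rewrite ltcR => /(_ e0); apply: filterS => n h.
have : `| `|v w| - `|s n w| | < e%:C%C by apply: le_lt_trans h; exact: ler_dist_dist.
have : complex.Im `|v w| = 0 /\ complex.Im `|s n w| = 0 by rewrite !ger0_Im.
case: (`|v w|) (`|s n w|) => [a b] [a' b'] /= [-> ->].
by rewrite normc_def ltcR /= subrr expr0n addr0 sqrtr_sqr.
Qed.
End sections.

Section L0H.
Context (R : realType) (d : measure_display) (Omega : measurableType d).
Variable mu : {measure set Omega -> \bar R}.
Local Notation C := R[i].
Local Notation L0 := (L0 mu).

Record mbundle := MBundle {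
  fiber : Omega -> hilbertType R ;
  csections : set (bsection mu fiber) ;
  mbundleP : is_mbundle csections
}.

Arguments csections : clear implicits.

Variable X : mbundle.
Local Notation H := (fiber X).

Record msection := MSection {
  msec :> bsection mu H ;
  msecP : bmeasurable (csections X) msec
}.

HB.instance Definition _ := gen_eqMixin msection.
HB.instance Definition _ := gen_choiceMixin msection.

(* Both sides are defined a.e., so this is equality of the values a.e. *)
Definition msection_eq (u v : msection) := `[< \forall w \ae mu, u w = v w >].

Let msection_eq_refl : reflexive msection_eq.
Proof. by move=> f; apply/asboolP; apply: aeW. Qed.

Let msection_eq_sym : symmetric msection_eq.
Proof.
by move=> f g; apply/asboolP/asboolP; apply: filterS => w ->.
Qed.

Let msection_eq_trans : transitive msection_eq.
Proof.
move=> g f h /asboolP fg /asboolP gh; apply/asboolP.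
by apply: filterS2 fg gh => w -> ->.
Qed.

Canonical msection_eq_equiv :=
  EquivRel msection_eq msection_eq_refl msection_eq_sym msection_eq_trans.

Definition L0H : Type := {eq_quot msection_eq}.
HB.instance Definition _ := Choice.on L0H.
HB.instance Definition _ := EqQuotient.on L0H.

Definition L0H_fun (x : L0H) : forall w, H w := bval (repr x : msection).
Coercion L0H_fun : L0H >-> Funclass.

Definition L0H_of (u : msection) : L0H := \pi_L0H u.

Lemma L0H_ofE (u : msection) : \forall w \ae mu, L0H_of u w = bval u w.
Proof.
have /eqmodP/asboolP : L0H_of (repr (L0H_of u)) = L0H_of u.
  by rewrite /L0H_of reprK.
by apply: filterS => w; rewrite /L0H_fun /bval => ->.
Qed.

Let odflt_inj (T : Type) (t : T) (a b : option T) :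
  odflt t a = odflt t b -> a -> b -> a = b.
Proof. by case: a => // a; case: b => //= b ->. Qed.

Lemma L0HP (x y : L0H) : (\forall w \ae mu, x w = y w) -> x = y.
Proof.
move=> xy; rewrite -[x]reprK -[y]reprK; apply/eqmodP; apply/asboolP.
have ex := bsec_ae (repr x : msection); have ey := bsec_ae (repr y : msection).
by apply: filterS3 xy ex ey => w; exact: odflt_inj.
Qed.

Definition tsection (v : forall w, H w) : bsection mu H :=
  brestrict (aeW mu (fun w : Omega => I : setT w)) v.

Lemma tsectionE v w : bval (tsection v) w = v w.
Proof. exact: bval_restrict. Qed.

Lemma tsection_meas v : tmeas (csections X) v ->
  bmeasurable (csections X) (tsection v).
Proof.
by apply: bmeasurable_tmeas; apply: aeW => w; exact: tsectionE.
Qed.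

Lemma L0H_ofmE v (mv : tmeas (csections X) v) :
  \forall w \ae mu, L0H_of (MSection (tsection_meas mv)) w = v w.
Proof.
apply: filterS (L0H_ofE (MSection (tsection_meas mv))) => w ->.
exact: tsectionE.
Qed.

Lemma L0H_tmeas (x : L0H) : tmeas (csections X) x.
Proof. exact: tmeas_bmeasurable (msecP _). Qed.

Lemma L0_cmeas (f : L0) : cmeasurable f.
Proof. exact: cmfunP. Qed.

Definition L0H_zero : L0H := L0H_of (MSection (tsection_meas (tmeas0 _))).
Definition L0H_add (x y : L0H) : L0H :=
  L0H_of (MSection (tsection_meas (tmeasD (L0H_tmeas x) (L0H_tmeas y)))).
Definition L0H_scale (f : L0) (x : L0H) : L0H :=
  L0H_of (MSection (tsection_meas
    (tmeas_scale (mbundleP X) (L0_cmeas f) (L0H_tmeas x)))).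
Definition L0H_opp (x : L0H) : L0H := L0H_scale (-1) x.

Lemma L0H_zeroE : \forall w \ae mu, L0H_zero w = 0.
Proof. exact: L0H_ofmE. Qed.
Lemma L0H_addE x y : \forall w \ae mu, L0H_add x y w = x w + y w.
Proof. exact: L0H_ofmE. Qed.
Lemma L0H_scaleE f x : \forall w \ae mu, L0H_scale f x w = f w *: x w.
Proof. exact: L0H_ofmE. Qed.
Lemma L0_ringE (f g : L0) :
  [/\ \forall w \ae mu, (f + g : L0) w = f w + g w,
      \forall w \ae mu, (f * g : L0) w = f w * g w,
      \forall w \ae mu, (- f : L0) w = - f w,
      \forall w \ae mu, (0 : L0) w = 0 &
      \forall w \ae mu, (1 : L0) w = 1].
Proof.
by split; [exact: L0_addE|exact: L0_mulE|exact: L0_oppE|exact: L0_cstE|exact: L0_cstE].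
Qed.

Local Ltac L0Hnear := apply: L0HP; near=> w.

Let L0H_addA : associative L0H_add.
Proof.
move=> x y z; L0Hnear.
rewrite (near (L0H_addE x (L0H_add y z)) w)// (near (L0H_addE y z) w)//.
rewrite (near (L0H_addE (L0H_add x y) z) w)// (near (L0H_addE x y) w)//.
exact: addrA.
Unshelve. all: by end_near. Qed.

Let L0H_addC : commutative L0H_add.
Proof.
move=> x y; L0Hnear.
by rewrite (near (L0H_addE x y) w)// (near (L0H_addE y x) w)// addrC.
Unshelve. all: by end_near. Qed.

Let L0H_add0 : left_id L0H_zero L0H_add.
Proof.
move=> x; L0Hnear.
by rewrite (near (L0H_addE L0H_zero x) w)// (near L0H_zeroE w)// add0r.
Unshelve. all: by end_near. Qed.

Let L0H_addN : left_inverse L0H_zero L0H_opp L0H_add.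
Proof.
move=> x; have [_ _ n1 _ o1] := L0_ringE 1 1; L0Hnear.
rewrite (near (L0H_addE (L0H_opp x) x) w)// (near (L0H_scaleE (-1) x) w)//.
by rewrite (near L0H_zeroE w)// (near n1 w)// (near o1 w)// scaleN1r addNr.
Unshelve. all: by end_near. Qed.

HB.instance Definition _ :=
  GRing.isZmodule.Build L0H L0H_addA L0H_addC L0H_add0 L0H_addN.

Let L0H_scaleA (f g : L0) (x : L0H) :
  L0H_scale f (L0H_scale g x) = L0H_scale (f * g) x.
Proof.
have [_ fg _ _ _] := L0_ringE f g; L0Hnear.
rewrite (near (L0H_scaleE f (L0H_scale g x)) w)// (near (L0H_scaleE g x) w)//.
by rewrite (near (L0H_scaleE (f * g) x) w)// (near fg w)// scalerA.
Unshelve. all: by end_near. Qed.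

Let L0H_scale1 : left_id 1 L0H_scale.
Proof.
move=> x; have [_ _ _ _ o1] := L0_ringE 1 1; L0Hnear.
by rewrite (near (L0H_scaleE 1 x) w)// (near o1 w)// scale1r.
Unshelve. all: by end_near. Qed.

Let L0H_scaleDr : right_distributive L0H_scale +%R.
Proof.
move=> f x y; L0Hnear.
rewrite (near (L0H_scaleE f (x + y)) w)// (near (L0H_addE x y) w)//.
rewrite (near (L0H_addE (L0H_scale f x) (L0H_scale f y)) w)//.
by rewrite (near (L0H_scaleE f x) w)// (near (L0H_scaleE f y) w)// scalerDr.
Unshelve. all: by end_near. Qed.

Let L0H_scaleDl x : {morph L0H_scale^~ x : f g / f + g}.
Proof.
move=> f g; have [fg _ _ _ _] := L0_ringE f g; L0Hnear.
rewrite (near (L0H_scaleE (f + g) x) w)// (near fg w)//.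
rewrite (near (L0H_addE (L0H_scale f x) (L0H_scale g x)) w)//.
by rewrite (near (L0H_scaleE f x) w)// (near (L0H_scaleE g x) w)// scalerDl.
Unshelve. all: by end_near. Qed.

HB.instance Definition _ := GRing.Zmodule_isLmodule.Build L0 L0H
  L0H_scaleA L0H_scale1 L0H_scaleDr L0H_scaleDl.

(* Completeness of mu makes the pointwise norm measurable. *)
Hypothesis cmu : measure_is_complete mu.

Definition L0H_norm (x : L0H) : L0 :=
  L0_of mu (CMfun (tmeas_norm (mbundleP X) cmu (L0H_tmeas x))).

Lemma L0H_normE x : \forall w \ae mu, L0H_norm x w = `|x w|.
Proof. exact: L0_ofE. Qed.

Definition L0H_bounded_set (B : set L0H) := L0_order_bounded (L0H_norm @` B).

Definition L0_bounded (T : L0H -> L0H) :=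
  forall B, L0H_bounded_set B -> L0H_bounded_set (T @` B).

(* N is the L0-valued norm of T, the supremum being taken in L0; such an N
   exists (and is unique) for L0-bounded T, as L0 is order complete. *)
Definition is_L0_opnorm (T : L0H -> L0H) (N : L0) :=
  supremums [set L0H_norm (T x) | x in [set x | L0H_norm x <= 1]] N.

Definition L0_contraction (T : {linear L0H -> L0H}) :=
  L0_bounded T /\ exists2 N, is_L0_opnorm T N & N <= 1.

Definition L0H_cvg (x : nat -> L0H) :=
  exists l, L0_ocvg (fun n => L0H_norm (x n - l)) 0.

(* At n = 0 the sum is empty, so the average is 0. *)
Definition subseq_avg (k : nat -> nat) (T : L0H -> L0H) (u : L0H) (n : nat) : L0H :=
  L0_cst mu n%:R^-1 *: \sum_(1 <= j < n.+1) iter (k j) T u.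

End L0H.

Arguments csections {R d Omega mu} m _.

(* Main.v *)
(** For almost every [w] the orbit [v i = (T^i u)(w)] is moved by a contraction
of its closed span (quantify over the countably many rational coefficient
sequences, then use density), so everything reduces to one Hilbert space. There
the Toeplitz form of the correlations [<v i, v 0>] dominates [|p(T) v 0|^2] and
is the limit of the positive functionals [f |-> (1/2N) sum_z f(z) F_N(z)], where
[z] ranges over the [2N]-th roots of unity and [F_N] is the [N]-th Fejer mean of
the correlations. An ultrafilter limit [I] of these functionals plays the role
of the spectral measure: [|p(T) v 0|^2 <= I |p|^2]. The averages
[n^-1 sum_j z^(k j)] are bounded by 1 and converge at every point [z] of the
circle, so bounded convergence for [I] makes the averages of the orbit a Cauchy
sequence. *)

Require Import Defs.
From HB Require Import structures.
From mathcomp Require Import all_boot all_order all_algebra complex.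
From mathcomp Require Import sesquilinear.
From mathcomp Require Import all_classical all_reals all_analysis.
From mathcomp Require Import measurable_realfun.
From mathcomp Require Import ring lra zify.

Set Implicit Arguments.
Unset Strict Implicit.
Unset Printing Implicit Defensive.

Import Order.TTheory GRing.Theory Num.Theory numFieldNormedType.Exports.

Local Open Scope classical_set_scope.
Local Open Scope ring_scope.

(** * Bounded convergence for a positive functional *)

Section bounded_convergence.
Context (R : realType).
Implicit Types (g h : R -> R) (a b : R).

(** Compactness: the open sets where [g n < e] increase with [n], so the largest index of a finite
    subcover serves the whole segment. *)
Lemma dini_cvg0 (g : nat -> R -> R) a b : (forall n, continuous (g n)) ->
  (forall t n m, (n <= m)%N -> g m t <= g n t) ->
  (forall t (e : R), 0 < e -> exists n, g n t < e) ->
  forall e : R, 0 < e -> exists n, forall t, t \in `[a, b] -> g n t < e.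
Proof.
move=> cg dg g0 e e0.
have := @segment_compact R a b; rewrite compact_cover => /(_ nat setT).
move=> /(_ (fun n => g n @^-1` [set x | x < e])) [n _||D _ Dcov].
- by apply: open_comp => [t _|]; [exact: cg|exact: open_lt].
- by move=> t _; have [n gn] := g0 t e e0; exists n.
exists (\max_(i <- finmap.enum_fset D) i)%N => t tab.
have [i /= iD git] := Dcov t tab.
apply: le_lt_trans git; apply: dg.
exact: (@leq_bigmax_seq _ _ xpredT id).
Qed.

(** Everything is confined to functions with values in [[0, B]], for which the ultrafilter limit
    used later exists; [modI] is the form of additivity that stays inside this class. *)
Variables (a b B K : R) (I : (R -> R) -> R).
Local Notation "'D" := [set h : R -> R | forall t, 0 <= h t <= B].
Hypotheses (K0 : 0 <= K)
  (leI : forall g h, 'D g -> 'D h -> (forall t, t \in `[a, b] -> g t <= h t) ->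
    I g <= I h)
  (modI : forall g h, 'D g -> 'D h -> I (g \min h) + I (g \max h) = I g + I h)
  (smallI : forall h (e : R), 'D h -> 0 < e ->
    (forall t, t \in `[a, b] -> h t <= e) ->
    I h <= e * K).

Fixpoint fmax (f : nat -> R -> R) n p : R -> R :=
  if p is p'.+1 then fmax f n p' \max f (n + p)%N else f n.

(* Luxemburg's argument: the finite maxima [h n] nearly exhaust
   [sup_(m >= n) f m], so their successive minima still have a large integral
   while decreasing to 0; Dini's theorem applies to the latter. *)
Lemma bounded_convergence (f : nat -> R -> R) :
  (forall n, continuous (f n)) -> (forall n, 'D (f n)) ->
  (forall t, (f ^~ t) @ \oo --> 0) ->
  forall e : R, 0 < e -> exists n, I (f n) < e.
Proof.
move=> cf Df f0 e e0; apply: contrapT => /forallNP If.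
have {}If n : e <= I (f n) by rewrite leNgt; apply/negP; exact: If.
have Dmax g h : 'D g -> 'D h -> 'D (g \max h).
  move=> /= Dg Dh t; have /andP[? ?] := Dg t; have /andP[? ?] := Dh t.
  by rewrite le_max ge_max; apply/andP; split; [apply/orP; left|apply/andP].
have Dmin g h : 'D g -> 'D h -> 'D (g \min h).
  move=> /= Dg Dh t; have /andP[? ?] := Dg t; have /andP[? ?] := Dh t.
  by rewrite le_min ge_min; apply/andP; split; [apply/andP|apply/orP; left].
have DM n p : 'D (fmax f n p).
  by elim: p => [|p ih]; [exact: Df|exact: Dmax _ _ ih (Df _)].
have cM n p : continuous (fmax f n p).
  elim: p => [|p ih] t; first exact: cf.
  exact: (@continuous_max R R _ _ t (ih t) (cf _ t)).
have MP n p t c : reflect (forall i, (n <= i <= n + p)%N -> f i t <= c)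
    (fmax f n p t <= c).
  elim: p => [|p ih] /=.
    rewrite addn0; apply: (iffP idP) => [h i|]; last by apply; rewrite leqnn.
    by rewrite -eqn_leq => /eqP <-.
  rewrite ge_max; apply: (iffP andP) => [[/ih h1 h2] i|h].
    move=> /andP[ni]; rewrite leq_eqVlt => /orP[/eqP -> //|].
    by rewrite addnS ltnS => ip; apply: h1; rewrite ni.
  split; last by apply: h; rewrite leqnn leq_addr.
  apply/ih => i /andP[ni ip]; apply: h.
  by rewrite ni/= (leq_trans ip)// leq_add2l.
have f_leM n p i t : (n <= i <= n + p)%N -> f i t <= fmax f n p t.
  by move=> ni; apply: (elimT (MP n p t _) (lexx _)).
pose S n := [set I (fmax f n p) | p in setT].
have supS n : has_sup (S n).
  split; first by exists (I (fmax f n 0)), 0%N.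
  exists (I (cst B)) => _ [p _ <-]; apply: leI => //.
    by move=> t /=; have /andP[? ?] := Df 0%N t; rewrite lexx andbT; lra.
  by move=> t _; have /andP[] := DM n p t.
(* The tolerances [e / 2 ^+ n.+2] sum to [e / 2], so the successive minima [g n] keep at least
   [e / 2]. *)
have /choice[p pP] n : exists p, sup (S n) - e / 2 ^+ n.+2 < I (fmax f n p).
  have [|_ [p _ <-] h] := @sup_adherent _ (S n) (e / 2 ^+ n.+2) _ (supS n).
    by rewrite divr_gt0// exprn_gt0.
  by exists p.
pose h n := fmax f n (p n).
pose fix g n := if n is n'.+1 then g n' \min h n'.+1 else h 0%N.
have Dg n : 'D (g n).
  by elim: n => [|n ih]; [exact: DM|exact: Dmin _ _ ih (DM _ _)].
have g_leh n t : g n t <= h n t by case: n => //= n; rewrite ge_min lexx orbT.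
(* A longer finite maximum starting at [n] dominates both functions, so the left side is at most
   [sup (S n)]. *)
have hmax n : I (h n \max h n.+1) <= I (h n) + e / 2 ^+ n.+2.
  rewrite -lerBlDr; apply: ltW; apply: le_lt_trans (pP n); rewrite lerD2r.
  apply: (@le_trans _ _ (I (fmax f n (p n + (p n.+1).+1)))); last first.
    by apply: sup_upper_bound => //; exists (p n + (p n.+1).+1)%N.
  apply: leI => [||t _]; [exact: Dmax _ _ (DM _ _) (DM _ _)|exact: DM|].
  rewrite ge_max; apply/andP; split; apply/MP => i ip; apply: f_leM; lia.
(* By modularity and [g n <= h n], each new minimum adds at most [e / 2 ^+ n.+2] to the deficit of
   [I (g n)] against [I (h n)]. *)
have Ig n : I (h n) - e / 2 * (1 - (2 ^+ n)^-1) <= I (g n).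
  elim: n => [|n ih]; first by rewrite expr0 invr1; lra.
  have := modI (Dg n) (DM n.+1 (p n.+1)).
  have : I (g n \max h n.+1) <= I (h n \max h n.+1).
    apply: leI => [||t _].
    - exact: Dmax _ _ (Dg _) (DM _ _).
    - exact: Dmax _ _ (DM _ _) (DM _ _).
    - by rewrite /= ge_max !le_max g_leh lexx orbT.
  have := hmax n; move: ih; rewrite /= -/(h n.+1) !exprS !invfM.
  set x := (2 ^+ n)^-1; set y := I (g n); set z := I (h n.+1).
  set w := I (h n); set u := I (_ \max _); set v := I (_ \max _).
  set r := I (_ \min _).
  by move=> h1 h2 h3 h4; nra.
have Ige n : e / 2 <= I (g n).
  apply: le_trans (Ig n).
  have : I (f n) <= I (h n).
    by apply: leI => // [|t _]; [exact: DM|apply: f_leM; lia].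
  have : 0 < (2 ^+ n)^-1 :> R by rewrite invr_gt0 exprn_gt0.
  have := If n; nra.
have K1 : 0 < K + 1 by rewrite ltr_wpDl.
(* Once [g n] is below this threshold, [I (g n) <= e / 4], against [Ige]; [K + 1] keeps the
   denominator positive when [K = 0]. *)
have e1 : 0 < e / 4 / (K + 1) by apply: divr_gt0 => //; exact: divr_gt0.
have [||||n gn] := @dini_cvg0 g a b _ _ _ (e / 4 / (K + 1)).
- elim=> [|n ih] t; first exact: cM.
  exact: (@continuous_min R R _ _ t (ih t) (cM _ _ t)).
- move=> t n m /subnK <-; elim: (m - n)%N => //= i ih.
  by rewrite (le_trans _ ih)// ge_min lexx.
- move=> t c c0; have c2 : 0 < c / 2 by lra.
  have /cvgrPdist_lt/(_ _ c2)[N _ NP] := f0 t.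
  exists N; apply: (le_lt_trans (g_leh _ _)).
  apply: (@le_lt_trans _ _ (c / 2)); last by lra.
  apply/MP => i /andP[Ni _]; have := NP i Ni.
  by rewrite sub0r normrN => /ltW; exact: le_trans (ler_norm _).
- exact: e1.
have := Ige n; apply/negP; rewrite -ltNge.
apply: (le_lt_trans (smallI (Dg n) e1 _)) => [t /gn /ltW //|].
have : e / 4 / (K + 1) * (K + 1) = e / 4 by rewrite divfK// gt_eqF.
nra.
Qed.

End bounded_convergence.

(** * The Toeplitz form of an orbit and its Fejer means *)

Lemma innerC (R : realType) (H : hilbertType R) (x y : H) :
  inner x y = (inner y x)^*.
Proof. by rewrite hermC expr0 mul1r. Qed.

Lemma innerZl (R : realType) (H : hilbertType R) a (x y : H) :
  inner (a *: x) y = a * inner x y.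
Proof. by rewrite linearZl_LR. Qed.

Lemma innerZr (R : realType) (H : hilbertType R) a (x y : H) :
  inner x (a *: y) = a^* * inner x y.
Proof. by rewrite linearZr. Qed.

Section toeplitz.
Context (R : realType) (H : hilbertType R) (v : nat -> H).
Local Notation C := R[i].

(** A function of [i - l] only: the Gram matrix that the orbit of [v 0] would have under a unitary
    dilation of the contraction. *)
Definition corr (i l : nat) : C :=
  if (l <= i)%N then inner (v (i - l)) (v 0%N)
  else (inner (v (l - i)) (v 0%N))^*.

Lemma corr_eq i l i' l' : (i + l' = l + i')%N -> corr i' l' = corr i l.
Proof.
move=> h; rewrite /corr.
have [li|il] := leqP l i.
  by rewrite ifT; [congr (inner (v _) _)|]; lia.
by rewrite ifF; [congr ((inner (v _) _)^*)|]; lia.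
Qed.

Definition toeplitz n (a : nat -> C) : C :=
  \sum_(i < n) \sum_(l < n) a i * (a l)^* * corr i l.

Hypothesis contr : forall n (a : nat -> C),
  `|\sum_(i < n) a i *: v i.+1| <= `|\sum_(i < n) a i *: v i|.

(* When the index 0 is split off, both sides grow by the same cross terms, up to
   the square of [|sum_i a i.+1 *: v i.+1|], which is at most
   [|sum_i a i.+1 *: v i|]. *)
Lemma toeplitz_ge n (a : nat -> C) :
  `|\sum_(i < n) a i *: v i| ^+ 2 <= toeplitz n a.
Proof.
elim: n a => [|n ih] a.
  by rewrite /toeplitz !big_ord0 normr0 expr0n.
rewrite big_ord_recl/=.
set S := \sum_(i < n) _.
have SE : inner S (a 0%N *: v 0%N) =
    \sum_(i < n) a i.+1 * (a 0%N)^* * corr i.+1 0.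
  rewrite innerZr linear_sumlz/= mulr_sumr; apply: eq_bigr => i _.
  by rewrite innerZl /corr /bump/= add1n subn0; ring.
have SE' : inner (a 0%N *: v 0%N) S =
    \sum_(l < n) a 0%N * (a l.+1)^* * corr 0 l.+1.
  rewrite innerC SE rmorph_sum/=; apply: eq_bigr => l _.
  by rewrite !rmorphM/= conjCK /corr/= subn0; ring.
have -> : toeplitz n.+1 a =
    inner (a 0%N *: v 0%N) (a 0%N *: v 0%N) + inner (a 0%N *: v 0%N) S +
    (inner S (a 0%N *: v 0%N) + toeplitz n (fun i => a i.+1)).
  rewrite SE SE' /toeplitz big_ord_recl/= big_ord_recl/=.
  congr (_ + _ + _); last first.
    rewrite -big_split/=; apply: eq_bigr => i _.
    by rewrite big_ord_recl/=; congr (_ + _).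
  by rewrite innerZr innerZl /corr /= mulrCA mulrA.
rewrite sqr_norm_inner dnormD -innerC addrACA lerD2l addrC lerD2l.
apply: le_trans (ih (fun i => a i.+1)).
rewrite -sqr_norm_inner lerXn2r ?nnegrE//.
by have := contr n (fun i => a i.+1).
Qed.

Lemma toeplitz_ge0 n a : 0 <= toeplitz n a.
Proof. by apply: le_trans (toeplitz_ge n a); rewrite exprn_ge0. Qed.

End toeplitz.

(** * Roots of unity and discrete orthogonality *)

Section circle.
Context (R : realType).
Implicit Types (t : R) (n m N : nat).
Local Notation C := R[i].

Definition cis t : C := (cos t +i* sin t)%C.

Lemma cisX t n : cis t ^+ n = cis (t *+ n).
Proof.
elim: n => [|n ih]; first by rewrite expr0 mulr0n /cis cos0 sin0.
rewrite exprS ih mulrS /cis cosD sinD; simpc.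
by rewrite [sin t * _ + _]addrC.
Qed.

Lemma norm_cis t : `|cis t| = 1.
Proof. by rewrite normc_def /= cos2Dsin2 sqrtr1. Qed.

Lemma cis_conj t : cis t * (cis t)^* = 1.
Proof. by rewrite -normCK norm_cis expr1n. Qed.

(** Half angles: [cos t = 1 - 2 sin^2 (t / 2)], and [sin (t / 2) > 0] in this range. *)
Lemma cis_neq1 t : 0 < t < pi *+ 2 -> cis t != 1.
Proof.
move=> /andP[t0 t2]; apply/eqP => -[/eqP + _]; apply/negP.
have -> : t = (t / 2) *+ 2 by rewrite -mulr_natr divfK.
rewrite cos_mulr2n cos2sin2.
have : 0 < sin (t / 2) by apply: sin_gt0_pi; move: t2; rewrite mulr2n; lra.
by move=> s0; rewrite lt_eqF// mulr2n; nra.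
Qed.

Lemma sum_expr_root (rho : C) M : rho ^+ M = 1 -> rho != 1 ->
  \sum_(j < M) rho ^+ j = 0.
Proof.
move=> rM r1; have := subrX1 rho M; rewrite rM subrr.
by move=> /esym/eqP; rewrite mulf_eq0 subr_eq0 (negbTE r1) => /eqP.
Qed.

(** The angles of the [2N]-th roots of unity. *)
Definition node N (j : nat) : R := (pi / N%:R) *+ j.

Lemma node_itv N j : (j < N.*2)%N -> node N j \in `[0, pi *+ 2].
Proof.
move=> jN; have N0 : (0 < N)%N by lia.
rewrite in_itv/= /node mulrn_wge0 ?divr_ge0 ?pi_ge0//=.
rewrite -[leLHS]mulr_natr mulrAC ler_pdivrMr ?ltr0n//.
rewrite -[pi *+ 2]mulr_natr -mulrA.
by rewrite ler_wpM2l ?pi_ge0// -natrM ler_nat; lia.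
Qed.

(** Up to conjugation [q <= p]. If [q < p], this is a full geometric sum over a [2N]-th root of
    unity, which differs from 1 because [0 < p - q < 2N]. *)
Lemma sum_node N p q : (p < N.*2)%N -> (q < N.*2)%N ->
  \sum_(j < N.*2) cis (node N j) ^+ p * (cis (node N j) ^+ q)^* =
  (N.*2 * (p == q))%:R :> C.
Proof.
wlog pq : p q / (q <= p)%N => [wl pN qN|pN qN].
  have [qp|/ltnW pq] := leqP q p; first exact: wl.
  rewrite eq_sym -[RHS]conjC_nat -(wl q p)// rmorph_sum; apply: eq_bigr => j _.
  by rewrite /= rmorphM/= conjCK mulrC.
have N0 : (0 < N)%N by lia.
pose w := cis (pi / N%:R) ^+ (p - q).
have -> : \sum_(j < N.*2) cis (node N j) ^+ p * (cis (node N j) ^+ q)^* =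
    \sum_(j < N.*2) w ^+ j.
  apply: eq_bigr => j _; rewrite -{1}(subnK pq) exprD -mulrA.
  rewrite rmorphXn/= -exprMn cis_conj expr1n mulr1 /w /node.
  by rewrite [RHS]exprAC [in RHS]cisX.
have [epq|npq] := eqVneq p q.
  rewrite muln1 /w epq subnn expr0; under eq_bigr do rewrite expr1n.
  by rewrite sumr_const card_ord.
rewrite muln0; apply: sum_expr_root.
  rewrite /w exprAC cisX -muln2 mulrnA -[_ *+ N]mulr_natr.
  rewrite divfK ?pnatr_eq0; last by lia.
  by rewrite /cis cos2pi sin2pi expr1n.
rewrite /w cisX; apply: cis_neq1; rewrite -[_ *+ (p - q)]mulr_natr.
apply/andP; split; first by rewrite mulr_gt0 ?divr_gt0 ?pi_gt0 ?ltr0n//; lia.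
rewrite mulrAC ltr_pdivrMr ?ltr0n// -[pi *+ 2]mulr_natr -mulrA.
by rewrite ltr_pM2l ?pi_gt0// -natrM ltr_nat; lia.
Qed.

End circle.

(** The length of the diagonal [i' - l' = i - l] in an [N] by [N] square; for [|i - l| <= N],
    dividing by [N] gives the Fejer weight [1 - |i - l| / N]. *)
Definition diag_count (N i l : nat) : nat :=
  (\sum_(i' < N) \sum_(l' < N) (i + l' == l + i'))%N.

Lemma diag_count_bounds N n i l : (i < n)%N -> (l < n)%N ->
  (diag_count N i l <= N <= diag_count N i l + n.*2)%N.
Proof.
move=> ni nl.
have E K x : (\sum_(l' < K) (i + l' == x) = (i <= x < i + K))%N.
  by elim: K => [|K ih]; [rewrite big_ord0|rewrite big_ord_recr/= ih]; lia.
have dE : diag_count N i l = (\sum_(i' < N) (i <= l + i' < i + N))%N.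
  by apply: eq_bigr => i' _; rewrite E.
(* An index [i'] is missed only if [i' < n] or [N - n <= i']; the two extra terms count such indices
   below [K]. *)
have B K : (\sum_(i' < K) (i <= l + i' < i + N) <= K <=
    \sum_(i' < K) (i <= l + i' < i + N) + minn K n + (K - (N - n)))%N.
  by elim: K => [|K ih]; [rewrite big_ord0|move: ih; rewrite big_ord_recr/=;
    set S := (\sum_(i' < K) _)%N]; lia.
by have := B N; rewrite dE; lia.
Qed.

Lemma diag_count_cvg (R : realType) i l :
  (diag_count N i l)%:R / N%:R @[N --> \oo] --> (1 : R).
Proof.
pose n := (maxn i l).+1.
have h0 : N%:R^-1 @[N --> \oo] --> (0 : R).
  by rewrite -cvg_shiftS; exact: cvg_harmonic.
have cl : 1 - n.*2%:R * N%:R^-1 @[N --> \oo] --> (1 : R).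
  rewrite -[X in _ --> X]subr0 -[X in _ - X](mulr0 (n.*2%:R : R)).
  by apply: cvgB; [exact: cvg_cst|apply: cvgMr].
apply: (squeeze_cvgr _ cl (cvg_cst (1 : R))).
near=> N; have N0 : 0 < N%:R :> R by rewrite ltr0n; near: N; exists 1%N.
have /andP[h1 h2] : (diag_count N i l <= N <= diag_count N i l + n.*2)%N.
  by apply: diag_count_bounds; rewrite /n; lia.
rewrite ler_pdivrMr// mul1r ler_nat h1 andbT.
rewrite ler_pdivlMr// mulrBl mul1r divfK ?gt_eqF// lerBlDr -natrD ler_nat//.
Unshelve. all: by end_near. Qed.

Section rnorm.
Context (R : realType) (V : normedModType R[i]).
Implicit Types x y : V.

(** Norms are real elements of the partially ordered [R[i]]; moving them to [R] gives access to the
    total order, suprema and real limits. *)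
Definition rnorm x : R := complex.Re `|x|.

Lemma rnormE x : `|x| = (rnorm x)%:C%C.
Proof. by rewrite RRe_real// normr_real. Qed.

Lemma rnorm_ge0 x : 0 <= rnorm x.
Proof. by rewrite -ler0c -rnormE. Qed.

Lemma rnorm_sqr x : complex.Re (`|x| ^+ 2) = rnorm x ^+ 2.
Proof. by rewrite rnormE -rmorphXn. Qed.

Lemma ler_rnormD x y : rnorm (x + y) <= rnorm x + rnorm y.
Proof. by rewrite -lecR rmorphD/= -!rnormE ler_normD. Qed.

Lemma rnormN x : rnorm (- x) = rnorm x.
Proof. by rewrite /rnorm normrN. Qed.

Lemma ler_rnorm_dist z x y : rnorm (x - y) <= rnorm (x - z) + rnorm (y - z).
Proof.
rewrite -[rnorm (y - z)]rnormN opprB (le_trans _ (ler_rnormD _ _))//.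
by rewrite addrA subrK.
Qed.

Lemma rnormZ (a : R) x : 0 <= a -> rnorm (a%:C%C *: x) = a * rnorm x.
Proof.
move=> a0; apply: (@complexI R); rewrite -rnormE normrZ rmorphM/= rnormE.
by congr (_ * _); rewrite ger0_norm// ler0c.
Qed.

Lemma cvg_rnorm (T : Type) (F : set_system T) (FF : Filter F) (f : T -> V) l :
  (f @ F --> l) <-> (rnorm (f x - l) @[x --> F] --> 0).
Proof.
split=> [/cvgrPdist_lt fl|/cvgrPdist_lt fl].
  apply/cvgrPdist_lt => e e0; have := fl e%:C%C; rewrite ltcR => /(_ e0).
  apply: filterS => x; rewrite rnormE ltcR sub0r normrN ger0_norm ?rnorm_ge0//.
  by rewrite -[rnorm (f x - l)]/(complex.Re _) distrC.
apply/cvgrPdist_lt => e e0.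
have eE : e = (complex.Re e)%:C%C by rewrite RRe_real// gtr0_real.
rewrite eE ltcR in e0; have := fl _ e0; rewrite eE; apply: filterS => x.
by rewrite sub0r normrN ger0_norm ?rnorm_ge0// distrC rnormE ltcR.
Qed.

End rnorm.

Lemma ReM_ge0 (R : realType) (x y : R[i]) : 0 <= y ->
  complex.Re (x * y) = complex.Re x * complex.Re y.
Proof.
move=> /ger0_real/RRe_real {1}<-; rewrite mulrC.
by case: x => a b /=; rewrite mul0r subr0 mulrC.
Qed.

(** * Fejer sums as positive functionals *)

Section trigonometric_mean.
Context (R : realType) (H : hilbertType R) (v : nat -> H).
Local Notation C := R[i].
Hypothesis contr : forall n (a : nat -> C),
  `|\sum_(i < n) a i *: v i.+1| <= `|\sum_(i < n) a i *: v i|.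

(** This is [N] times the Fejer mean of the correlations, nonnegative by [toeplitz_ge0]; the second
    division in [fejer_mean] removes the factor [N]. *)
Definition fejer N (t : R) : R :=
  complex.Re (toeplitz v N (fun i => (cis t ^+ i)^*)).

Definition fejer_mean N (f : R -> R) : R :=
  (\sum_(j < N.*2) f (node R N j) * fejer N (node R N j)) / N.*2%:R / N%:R.

Definition trig n (a : nat -> C) (t : R) : C := \sum_(i < n) a i * cis t ^+ i.

Lemma toeplitzE n (a : nat -> C) : toeplitz v n a =
  \sum_(x : 'I_n * 'I_n) a x.1 * (a x.2)^* * corr v x.1 x.2.
Proof. by rewrite /toeplitz pair_big. Qed.

(* Summing over the [2N]-th roots of unity is exact here, as all exponents are
   smaller than [2N]. *)
Lemma fejer_mean_trigE N n (a : nat -> C) : (n <= N)%N ->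
  fejer_mean N (fun t => rnorm (trig n a t : C^o) ^+ 2) =
  \sum_(x : 'I_n * 'I_n) complex.Re (a x.1 * (a x.2)^* * corr v x.1 x.2) *
    ((diag_count N x.1 x.2)%:R / N%:R).
Proof.
move=> nN; have [->|N0] := posnP N.
  rewrite /fejer_mean invr0 mulr0 big1// => x _.
  by rewrite mulr0 mulr0.
have N2 : N.*2%:R != 0 :> R by rewrite pnatr_eq0; lia.
rewrite /fejer_mean; under eq_bigr => j _.
  rewrite -rnorm_sqr -ReM_ge0 ?toeplitz_ge0//.
  rewrite normCK /trig rmorph_sum big_distrlr/= pair_big/= toeplitzE.
  rewrite big_distrlr/=; over.
rewrite -raddf_sum/= exchange_big/= raddf_sum/= mulr_suml mulr_suml.
apply: eq_bigr => x _; rewrite exchange_big/=.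
under eq_bigr => y _.
  rewrite (eq_bigr (fun j : 'I_N.*2 => (a x.1 * (a x.2)^* * corr v y.1 y.2) *
    (cis (node R N j) ^+ (x.1 + y.2) * (cis (node R N j) ^+ (x.2 + y.1))^*))).
    rewrite -mulr_sumr sum_node; last 2 first.
      by have := ltn_ord x.1; have := ltn_ord y.2; lia.
      by have := ltn_ord x.2; have := ltn_ord y.1; lia.
    (* Only the [y] on the diagonal of [x] survive, and there [corr_eq] replaces the correlation at
       [y] by the one at [x]. *)
    rewrite (_ : _ * _ = (a x.1 * (a x.2)^* * corr v x.1 x.2) *
       (N.*2 * (x.1 + y.2 == x.2 + y.1)%N)%N%:R); last first.
      have [/corr_eq -> //|_] := eqVneq (x.1 + y.2)%N (x.2 + y.1)%N.
      by rewrite muln0 !mulr0.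
    over.
  move=> j _; rewrite !rmorphM/= !conjCK !exprD !rmorphM/=.
  set z := cis _; set u := corr _ _ _.
  by ring.
rewrite -mulr_sumr -natr_sum -big_distrr/=.
rewrite -(pair_big xpredT xpredT
  (fun i' l' : 'I_N => nat_of_bool (x.1 + l' == x.2 + i')%N))/=.
rewrite -/(diag_count _ _ _) -(rmorph_nat (real_complex R)).
rewrite ReM_ge0 ?ler0c ?ler0n//= natrM -!mulrA; congr (_ * _).
by rewrite mulrCA mulVKf.
Qed.

Lemma fejer_mean_trig_cvg n (a : nat -> C) :
  fejer_mean N (fun t => rnorm (trig n a t : C^o) ^+ 2) @[N --> \oo] -->
  complex.Re (toeplitz v n a).
Proof.
have -> : complex.Re (toeplitz v n a) = \sum_(x : 'I_n * 'I_n)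
    complex.Re (a x.1 * (a x.2)^* * corr v x.1 x.2) * 1.
  by rewrite toeplitzE raddf_sum; apply: eq_bigr => x _; rewrite mulr1.
have h : \sum_(x : 'I_n * 'I_n)
    complex.Re (a x.1 * (a x.2)^* * corr v x.1 x.2) *
    ((diag_count N x.1 x.2)%:R / N%:R) @[N --> \oo] --> \sum_(x : 'I_n * 'I_n)
    complex.Re (a x.1 * (a x.2)^* * corr v x.1 x.2) * 1.
  apply: cvg_big; first exact: add_continuous.
  by move=> x _; apply: cvgMr; exact: diag_count_cvg.
apply: cvg_trans h; apply: near_eq_cvg; near=> N.
by rewrite fejer_mean_trigE//; near: N; exact: nbhs_infty_ge.
Unshelve. all: by end_near. Qed.

Lemma fejer_mean_le N f g : (forall t, t \in `[0, pi *+ 2] -> f t <= g t) ->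
  fejer_mean N f <= fejer_mean N g.
Proof.
move=> fg; rewrite /fejer_mean !ler_wpM2r ?invr_ge0// ler_sum// => j _.
by rewrite ler_wpM2r ?fg ?node_itv// -ler0c RRe_real ?ger0_real// toeplitz_ge0.
Qed.

Lemma fejer_meanD N f g :
  fejer_mean N (f \+ g) = fejer_mean N f + fejer_mean N g.
Proof.
rewrite /fejer_mean -!mulrDl -big_split/=; congr (_ / _ / _).
by apply: eq_bigr => j _; rewrite mulrDl.
Qed.

Lemma fejer_meanZ N c f : fejer_mean N (fun t => c * f t) = c * fejer_mean N f.
Proof.
by rewrite /fejer_mean !mulrA mulr_sumr; congr (_ / _ / _);
  apply: eq_bigr => j _; rewrite mulrA.
Qed.

Lemma fejer_mean1_bounded :
  exists2 K, 0 <= K & forall N, fejer_mean N (cst 1) <= K.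
Proof.
pose c (x : 'I_1 * 'I_1) := complex.Re (1 * 1^* * corr v x.1 x.2).
exists (\sum_x `|c x|) => [|N]; first exact: sumr_ge0.
have [->|N0] := posnP N.
  by rewrite /fejer_mean invr0 mulr0; apply: sumr_ge0.
(* The constant 1 is the squared modulus of the trigonometric polynomial 1, so the exact formula
   applies from [N = 1] on. *)
rewrite (_ : cst 1 = fun t => rnorm (trig 1 (fun=> 1) t : C^o) ^+ 2).
  rewrite fejer_mean_trigE//; apply: ler_sum => x _.
  apply: le_trans (ler_norm _) _; rewrite normrM ler_piMr// ger0_norm.
    rewrite ler_pdivrMr ?ltr0n// mul1r ler_nat.
    by have /andP[] := @diag_count_bounds N 1 x.1 x.2 (ltn_ord _) (ltn_ord _).
  by rewrite divr_ge0.
apply/funext => t; rewrite -rnorm_sqr /trig big_ord1 expr0 mulr1 normr1.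
by rewrite expr1n.
Qed.

End trigonometric_mean.

(** * Convergence in a single Hilbert space *)

Section ultralimit.
Context (R : realType) (U : set_system nat) (UU : UltraFilter U).

Lemma ultra_fmap (f : nat -> R) : UltraFilter (f @ U).
Proof.
split; first exact: fmap_proper_filter.
move=> G PG UG; apply/seteqP; split=> // A GA.
have [//|UA] := in_ultra_setVsetC (f @^-1` A) UU.
have : G (A `&` ~` A) by apply: filterI => //; exact: UG.
by rewrite setICr => /filter_ex[].
Qed.

(** The image ultrafilter lives on a compact segment. *)
Lemma bounded_ultra_cvg (f : nat -> R) a b : (forall n, a <= f n <= b) ->
  cvg (f @ U).
Proof.
move=> fab; have := @segment_compact R a b; rewrite compact_ultra.
move=> /(_ (f @ U) (ultra_fmap f)) [|l [_ fl]]; last by apply/cvg_ex; exists l.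
by apply: (@filterE _ U) => n; rewrite /= in_itv/= fab.
Qed.

End ultralimit.

(** * Averages along [k] of one orbit *)

Section mean_ergodic.
Context (R : realType) (H : hilbertType R) (v : nat -> H) (k : nat -> nat).
Local Notation C := R[i].

(** Stated for any module, so that the orbit [v] and the characters [cis t ^+ i] are averaged with
    the same coefficients [avg_coef]. *)
Definition avg (V : lmodType C) (x : nat -> V) n : V :=
  n%:R^-1 *: \sum_(1 <= j < n.+1) x (k j).

Definition avg_coef n i : C := n%:R^-1 * \sum_(1 <= j < n.+1) (k j == i)%:R.

Lemma avg_coefE (V : lmodType C) (x : nat -> V) n N :
  (forall j, (1 <= j < n.+1)%N -> (k j < N)%N) ->
  \sum_(i < N) avg_coef n i *: x i = avg x n.
Proof.
move=> kN; rewrite /avg scaler_sumr.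
under eq_bigr do rewrite /avg_coef mulr_sumr scaler_suml.
rewrite exchange_big/=; apply: eq_big_nat => j /kN kjN.
rewrite (bigD1 (Ordinal kjN))//= eqxx mulr1 big1 ?addr0// => i ij.
rewrite (_ : (_ == _) = false) ?mulr0 ?scale0r//.
by apply/negbTE; apply: contra ij => /eqP e; apply/eqP/val_inj.
Qed.

Hypothesis contr : forall n (a : nat -> C),
  `|\sum_(i < n) a i *: v i.+1| <= `|\sum_(i < n) a i *: v i|.
Hypothesis k_avg : forall l : C, `|l| = 1 -> l != 1 ->
  (fun n : nat => n%:R^-1 * \sum_(1 <= j < n.+1) l ^+ k j : C^o) @ \oo
    --> (0 : C^o).

Lemma avg_expr_cvg t : cvg (avg (fun i => cis t ^+ i : C^o) n @[n --> \oo]).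
Proof.
have [t1|t1] := eqVneq (cis t) 1; last first.
  by apply/cvg_ex; exists 0; exact: k_avg (norm_cis t) t1.
(* At the point 1 the average equals 1 from [n = 1] on; at [n = 0] it is 0. *)
apply/cvg_ex; exists 1; apply: cvg_near_cst; near=> n.
rewrite /avg t1; under eq_bigr do rewrite expr1n.
rewrite sumr_const_nat subSS subn0 -[_ *: _]/(_ * _) mulVf// pnatr_eq0 -lt0n.
by near: n; exists 1%N.
Unshelve. all: by end_near. Qed.

Lemma continuous_cisX n :
  continuous (fun t => complex.Re (cis t ^+ n : C)) /\
  continuous (fun t => complex.Im (cis t ^+ n : C)).
Proof.
have cn : continuous (fun t : R => t *+ n).
  rewrite (_ : (fun _ => _) = (fun t => t * n%:R)).
    by move=> t; apply: cvgM; [exact: cvg_id|exact: cvg_cst].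
  by apply/funext => t; rewrite mulr_natr.
by split; under eq_fun do rewrite cisX /=; move=> t;
  apply: (continuous_comp (cn t));
  [exact: continuous_cos|exact: continuous_sin].
Qed.

Lemma continuous_rnorm_trig N (a : nat -> C) :
  continuous (fun t => rnorm (trig N a t : C^o) ^+ 2).
Proof.
suff [cr ci] : continuous (fun t => complex.Re (trig N a t)) /\
    continuous (fun t => complex.Im (trig N a t)).
  rewrite (_ : (fun _ => _) = (fun t =>
    complex.Re (trig N a t) * complex.Re (trig N a t) +
    complex.Im (trig N a t) * complex.Im (trig N a t))).
    by move=> t; exact: (cvgD (cvgM (cr t) (cr t)) (cvgM (ci t) (ci t))).
  apply/funext => s; rewrite -rnorm_sqr normc_def -rmorphXn/=.
  by rewrite sqr_sqrtr ?addr_ge0 ?sqr_ge0.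
elim: N => [|N [ihr ihi]].
  by rewrite /trig; split; under eq_fun do rewrite big_ord0/=;
    exact: cst_continuous.
have [cr ci] := continuous_cisX N.
split=> t.
  rewrite (_ : (fun _ => _) = (fun t => complex.Re (trig N a t)) \+
    (fun t => complex.Re (a N) * complex.Re (cis t ^+ N : C) -
              complex.Im (a N) * complex.Im (cis t ^+ N : C))).
    exact: (cvgD (ihr t) (cvgB (cvgM (cvg_cst _) (cr t))
      (cvgM (cvg_cst _) (ci t)))).
  by apply/funext => s; rewrite /trig big_ord_recr/= raddfD/=; congr (_ + _);
    case: (a N) (_ ^+ _) => [? ?] [? ?].
rewrite (_ : (fun _ => _) = (fun t => complex.Im (trig N a t)) \+
  (fun t => complex.Re (a N) * complex.Im (cis t ^+ N : C) +
            complex.Im (a N) * complex.Re (cis t ^+ N : C))).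
  exact: (cvgD (ihi t) (cvgD (cvgM (cvg_cst _) (ci t))
    (cvgM (cvg_cst _) (cr t)))).
by apply/funext => s; rewrite /trig big_ord_recr/= raddfD/=; congr (_ + _);
  case: (a N) (_ ^+ _) => [? ?] [? ?] /=; rewrite addrC.
Qed.

Lemma rnorm_avg_le1 t n : rnorm (avg (fun i => cis t ^+ i : C^o) n) <= 1.
Proof.
rewrite /avg -(rmorph_nat (real_complex R)) -fmorphV rnormZ ?invr_ge0//.
have [->|n0] := posnP n; first by rewrite invr0 mul0r.
rewrite ler_pdivrMl ?ltr0n// mulr1 -lecR -rnormE.
apply: le_trans (ler_norm_sum _ _ _) _.
under eq_bigr do rewrite normrX norm_cis expr1n.
by rewrite sumr_const_nat subSS subn0 rmorph_nat.
Qed.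

Definition avg_len n := (\max_(j < n.+1) k j).+1.

Lemma avg_lenP n j : (1 <= j < n.+1)%N -> (k j < avg_len n)%N.
Proof.
by move=> /andP[_ jn]; rewrite ltnS (leq_bigmax (Ordinal jn)).
Qed.

Lemma avg_diffE (V : lmodType C) (x : nat -> V) n m :
  \sum_(i < maxn (avg_len n) (avg_len m)) (avg_coef n i - avg_coef m i) *: x i =
  avg x n - avg x m.
Proof.
under eq_bigr do rewrite scalerBl.
by rewrite sumrB !avg_coefE// => j /avg_lenP jn; rewrite leq_max jn// orbT.
Qed.

(** By contradiction: averages that are not Cauchy give pairs [m <= n m] at distance at least [e].
    The same differences of characters have squared moduli [f m] in [[0, 4]] tending to 0, so some
    [I (f m)] is below the square of [e], while [toeplitz_ge] forces it to be at least that. *)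
Theorem mean_ergodic_cvg : cvg (avg v n @[n --> \oo]).
Proof.
apply/cauchy_cvgP/cauchyP => e e0; apply: contrapT => ncauchy.
(* Along an ultrafilter the bounded Fejer sums converge, and refining [\oo] preserves ordinary
   limits. *)
have [U [UU ooU]] := ultraFilterLemma (@eventually_filter).
have /choice[n nP] m : exists p, (m <= p)%N /\ ~ `|avg v m - avg v p| < e.
  apply: contrapT => /forallNP h; apply: ncauchy; exists (avg v m).
  exists m => // p /= mp; rewrite -ball_normE /=.
  by apply: contrapT => hp; exact: (h p).
pose a m i := avg_coef m i - avg_coef (n m) i.
pose N m := maxn (avg_len m) (avg_len (n m)).
pose f m t := rnorm (trig (N m) (a m) t : C^o) ^+ 2.
pose I g := lim (fejer_mean v M g @[M --> U]).
have [K K0 mK] := fejer_mean1_bounded contr.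
pose D := [set h : R -> R | forall t, 0 <= h t <= 4].
have bI h (M : nat) (c : R) : (forall t, 0 <= h t) ->
    (forall t, t \in `[0, pi *+ 2] -> h t <= c) -> 0 <= c ->
    0 <= fejer_mean v M h <= c * K.
  move=> h0 hc c0; apply/andP; split.
    have := fejer_mean_le contr M (fun t _ => h0 t); apply: le_trans.
    by rewrite /fejer_mean big1 ?mul0r// => j _; rewrite mul0r.
  apply: le_trans (ler_wpM2l c0 (mK M)); rewrite -fejer_meanZ.
  apply: (fejer_mean_le contr) => t.
  by move=> /hc; rewrite mulr1.
have cI h : D h -> cvg (fejer_mean v M h @[M --> U]).
  move=> Dh; apply: (@bounded_ultra_cvg _ _ _ _ 0 (4 * K)) => M.
  by apply: bI => // t; have /andP[] := Dh t.
(* The bound 4 is the square of [1 + 1], each character average having modulus at most 1. *)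
have Df m : D (f m).
  move=> t; rewrite sqr_ge0/= /f (_ : trig _ _ _ =
     avg (fun i => cis t ^+ i : C^o) m -
     avg (fun i => cis t ^+ i : C^o) (n m)); last exact: avg_diffE.
  rewrite (_ : 4 = 2 ^+ 2 :> R) ?ler_pXn2r ?nnegrE ?rnorm_ge0//; last first.
    by rewrite -natrX.
  apply: le_trans (ler_rnormD _ _) _; rewrite rnormN.
  by rewrite (_ : 2 = 1 + 1 :> R)// lerD ?rnorm_avg_le1.
have n_oo : n m @[m --> \oo] --> \oo.
  move=> A [M _ MA]; exists M => // m /= Mm.
  exact: MA (leq_trans Mm (nP m).1).
have re0 : 0 < complex.Re e by rewrite -ltcR RRe_real ?gtr0_real.
have [||||||m] := @bounded_convergence R 0 (pi *+ 2) 4 K I K0 _ _ _ f _ Df _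
  (complex.Re e ^+ 2) _.
- move=> g h Dg Dh gh; apply: ler_lim; [exact: cI|exact: cI|].
  by apply: nearW => M; exact: (fejer_mean_le contr).
- move=> g h Dg Dh.
  have Dmin : D (g \min h).
    move=> t /=; have := Dg t; have := Dh t.
    by rewrite le_min ge_min => /andP[-> _] /andP[-> ->].
  have Dmax : D (g \max h).
    move=> t /=; have := Dg t; have := Dh t.
    by rewrite le_max ge_max => /andP[-> ->] /andP[-> ->].
  (* The minimum and the maximum add up to [g + h] pointwise, so each Fejer sum is already
     modular. *)
  rewrite /I -!limD; try exact: cI.
  congr (lim (_ @ U)); apply/funext => M.
  rewrite -[LHS]/(fejer_mean v M (g \min h) + fejer_mean v M (g \max h)).
  rewrite -[RHS]/(fejer_mean v M g + fejer_mean v M h) -!fejer_meanD.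
  congr (fejer_mean _ _ _); apply/funext => t /=.
  by case: leP => _ //; rewrite addrC.
- move=> h c Dh c0 hc; apply: limr_le; first exact: cI.
  apply: nearW => M; have [|_ //] := andP (bI h M c _ hc (ltW c0)).
  by move=> t; have /andP[] := Dh t.
- by move=> m; exact: continuous_rnorm_trig.
(* Since [n m] tends to infinity with [m], both averages tend to the same [l]. *)
- move=> t; have /cvg_ex[l avl] := @avg_expr_cvg t.
  have /cvg_rnorm h1 := cvg_comp _ _ n_oo avl; have /cvg_rnorm h2 := avl.
  have h : rnorm (trig (N m) (a m) t : C^o) @[m --> \oo] --> 0.
    apply: (squeeze_cvgr _ (cvg_cst 0) _); last first.
      by rewrite -[X in _ --> X]addr0; exact: (cvgD h2 h1).
    apply: nearW => m; rewrite rnorm_ge0/= (_ : trig _ _ _ =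
      avg (fun i => cis t ^+ i : C^o) m -
      avg (fun i => cis t ^+ i : C^o) (n m)); last exact: avg_diffE.
    exact: ler_rnorm_dist.
  by rewrite -[X in _ --> X](mulr0 0); exact: (cvgM h h).
- by rewrite exprn_gt0.
apply/negP; rewrite -leNgt.
(* The Fejer sums of the squared modulus of a polynomial converge in the ordinary sense, so the
   limit along [U] is that limit. *)
have -> : I (f m) = complex.Re (toeplitz v (N m) (a m)).
  have h : fejer_mean v M (f m) @[M --> \oo] -->
      complex.Re (toeplitz v (N m) (a m)).
    exact: fejer_mean_trig_cvg.
  by apply: cvg_lim => // A /h; exact: ooU.
have [_ /negP] := nP m; rewrite -real_leNgt ?normr_real ?(gtr0_real e0)// => eA.
have := toeplitz_ge contr (N m) (a m); rewrite avg_diffE lecE => /andP[_].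
apply: le_trans; rewrite rnorm_sqr ler_pXn2r ?nnegrE ?rnorm_ge0 ?(ltW re0)//.
by move: eA; rewrite rnormE -[e in e <= _](RRe_real (gtr0_real e0)) lecR.
Qed.

End mean_ergodic.

(** * Almost everywhere limits of measurable sections *)

Section measurable_limits.
Context (R : realType) (d : measure_display) (Omega : measurableType d)
  (mu : {finite_measure set Omega -> \bar R}) (cmu : measure_is_complete mu)
  (X : mbundle mu).
Local Notation C := R[i].
Local Notation H := (fiber X).
Local Notation L := (csections X).
Implicit Types u v : forall w, H w.

Lemma tmeasB u v : tmeas L u -> tmeas L v -> tmeas L (fun w => u w - v w).
Proof.
move=> m_u mv; apply: tmeas_ae (tmeasD m_u (tmeasZ (mbundleP X) (-1) mv)).
by apply: aeW => w; rewrite scaleN1r.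
Qed.

Lemma measurable_rnorm u :
  tmeas L u -> measurable_fun setT (fun w => rnorm (u w)).
Proof. by move=> /(tmeas_norm (mbundleP X) cmu)[]. Qed.

Lemma tstep_tmeas u : tstep L u -> tmeas L u.
Proof.
by move=> su; exists (fun=> u) => //; apply: aeW => w; exact: cvg_cst.
Qed.

(** Egorov's theorem for the norms of the differences, [e] bounding both the exceptional measure and
    the error; finiteness of [mu] enters here. *)
Lemma tstep_approx u (e : R) : tmeas L u -> 0 < e ->
  exists t, tstep L t /\ exists B, [/\ measurable B, (mu B < e%:E)%E &
    forall w, ~ B w -> rnorm (t w - u w) < e].
Proof.
move=> m_u e0; have [s ss su] := m_u.
have mf n : measurable_fun setT (fun w => rnorm (s n w - u w)).
  by apply: measurable_rnorm; apply: tmeasB => //; exact: tstep_tmeas.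
have f0 : \forall w \ae mu, setT w ->
    (fun n => rnorm (s n w - u w)) @ \oo --> (cst 0 : Omega -> R) w.
  by apply: filterS su => w /cvg_rnorm.
have [||B [mB Be unif]] := ae_pointwise_almost_uniform mf _ measurableT _ f0 e0.
- exact: measurable_cst.
- by rewrite -ge0_fin_numE ?fin_num_measure.
have := unif [set h | forall w, ~ B w -> `|h w| < e].
case.
  apply/uniform_nbhs; exists [set xy : R * R | ball xy.1 e xy.2].
  split; first by exists e.
  move=> h /= hB w nBw; have := hB w (conj I nBw).
  by rewrite -ball_normE/= /cst sub0r normrN.
move=> n _ /(_ n (leqnn n)) nP; exists (s n); split => //.
exists B; split => // w /nP /=.
by rewrite ger0_norm ?rnorm_ge0.
Qed.

(* A step within [2^-(n+1)] of [s n] off a set of measure [2^-(n+1)] is, by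
   Borel-Cantelli, eventually that close to [s n] at almost every point. *)
Lemma tmeas_cvg (s : nat -> forall w, H w) u : (forall n, tmeas L (s n)) ->
  (\forall w \ae mu, s n w @[n --> \oo] --> u w) -> tmeas L u.
Proof.
move=> ms su.
have e0 n : 0 < 1 / (2 ^ n.+1)%:R :> R by rewrite divr_gt0// ltr0n expn_gt0.
have /choice[t tP] n := tstep_approx (ms n) (e0 n).
exists t => [n|]; first exact: (tP n).1.
have /choice[B BP] n := (tP n).2.
have mB n : measurable (B n) by case: (BP n).
have B0 : mu (lim_sup_set B) = 0%E.
  apply: lim_sup_set_cvg0 => //.
  apply: (@le_lt_trans _ _ (\sum_(n <oo) (1 / (2 ^ n.+1)%:R : R)%:E)%E).
    by apply: lee_nneseries => // n _; case: (BP n) => _ /ltW.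
  by apply: le_lt_trans (epsilon_trick0 xpredT ler01) _; exact: ltry.
have aeB : \forall w \ae mu, ~ lim_sup_set B w.
  exists (lim_sup_set B); split => //.
    apply: bigcap_measurable => // n _; exact: bigcup_measurable.
  by move=> w /= /contrapT.
apply: filterS2 aeB su => w; rewrite /lim_sup_set /bigcap/= => nB.
have [n nBn] : exists n, forall j, (n <= j)%N -> ~ B j w.
  apply: contrapT => /forallNP h; apply: nB => n _.
  by have /existsNP[j /not_implyP[nj /contrapT Bj]] := h n; exists j.
move=> /cvg_rnorm sw; apply/cvg_rnorm.
have h0 : 1 / (2 ^ n.+1)%:R @[n --> \oo] --> (0 : R).
  apply: (squeeze_cvgr _ (cvg_cst 0) cvg_harmonic); apply: nearW => m.
  rewrite ltW//= div1r lef_pV2 ?posrE ?ltr0n ?expn_gt0// ler_nat.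
  by rewrite ltnW// ltn_expl.
apply: (squeeze_cvgr _ (cvg_cst 0) _); last first.
  by rewrite -[X in _ --> X]addr0; exact: (cvgD h0 sw).
near=> m; rewrite rnorm_ge0/=.
rewrite -[t m w](subrK (s m w)) -addrA (le_trans (ler_rnormD _ _))// lerD2r.
have [_ _ /(_ w) h] := BP m; apply/ltW/h/nBn; near: m; exact: nbhs_infty_ge.
Unshelve. all: by end_near. Qed.

(** Values are taken through a chosen representative of the class, so operations commute with
    evaluation only almost everywhere. *)
Lemma L0H_funD (x y : L0H X) : \forall w \ae mu, (x + y : L0H X) w = x w + y w.
Proof. exact: L0H_addE. Qed.

Lemma L0H_funZ (f : L0 mu) (x : L0H X) :
  \forall w \ae mu, (f *: x : L0H X) w = f w *: x w.
Proof. exact: L0H_scaleE. Qed.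

Lemma L0H_fun0 : \forall w \ae mu, (0 : L0H X) w = 0.
Proof. exact: L0H_zeroE. Qed.

Lemma L0H_funB (x y : L0H X) : \forall w \ae mu, (x - y : L0H X) w = x w - y w.
Proof.
have [_ _ n1 _ o1] := L0_ringE (1 : L0 mu) 1.
rewrite -[- y]scaleN1r.
apply: filterS3 (L0H_funD x (-1 *: y)) (L0H_funZ (-1) y) (filterI n1 o1).
by move=> w -> -> [-> ->]; rewrite scaleN1r.
Qed.

Lemma L0H_fun_sum (r : seq nat) (x : nat -> L0H X) :
  \forall w \ae mu, (\sum_(i <- r) x i : L0H X) w = \sum_(i <- r) x i w.
Proof.
elim: r => [|i r ih].
  by apply: filterS L0H_fun0 => w h; rewrite !big_nil.
apply: filterS2 (L0H_funD (x i) (\sum_(i <- r) x i)) ih => w.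
by rewrite !big_cons => -> ->.
Qed.

(* The dominating sequence is the tail supremum of the norms, which are set to 0
   on the null set where they do not converge. *)
Lemma L0H_ocvg (x : nat -> L0H X) (l : L0H X) :
  (\forall w \ae mu, x n w @[n --> \oo] --> l w) ->
  L0_ocvg (fun n => L0H_norm cmu (x n - l)) 0.
Proof.
move=> xl; pose g n w := rnorm (x n w - l w).
have mg n : measurable_fun setT (g n).
  by apply: measurable_rnorm; apply: tmeasB; exact: L0H_tmeas.
have [N [mN N0 subN]] : \forall w \ae mu, g n w @[n --> \oo] --> 0.
  by apply: filterS xl => w /cvg_rnorm.
pose h n w := g n w * \1_(~` N) w.
have mh n : measurable_fun setT (h n).
  apply: measurable_funM; first exact: mg.
  by apply: measurable_indic; exact: measurableC.
have h0 n w : 0 <= h n w by rewrite mulr_ge0 ?rnorm_ge0.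
have hcvg w : h n w @[n --> \oo] --> 0.
  rewrite /h indicE; have [wN|wN] := boolP (w \in ~` N); last first.
    by under eq_fun do rewrite mulr0; exact: cvg_cst.
  under eq_fun do rewrite mulr1.
  by apply: contrapT => hw; move: wN; rewrite inE; apply; exact: subN.
have hE : \forall w \ae mu, forall n, h n w = g n w.
  exists N; split => // w /= hw; apply: contrapT => Nw; apply: hw => n.
  by rewrite /h indicE mem_set// mulr1.
have hub w : has_ubound (range (h ^~ w)).
  have /cvg_seq_bounded/pinfty_ex_gt0[M _ hM] : cvgn (h ^~ w).
    by apply/cvg_ex; exists 0.
  by exists M => _ [n _ <-]; apply: le_trans (ler_norm _) _; exact: hM.
have hsup n w : has_sup (sdrop (h ^~ w) n).
  split; first by exists (h n w), n => /=.
  by have [M Mub] := hub w; exists M => _ [m _ <-]; apply: Mub; exists m.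
pose S n w := sups (h ^~ w) n.
have leS n m w : (n <= m)%N -> h m w <= S n w.
  by move=> nm; apply: sup_upper_bound => //; exists m.
have Sle n w c : (forall m, (n <= m)%N -> h m w <= c) -> S n w <= c.
  move=> hc; apply: ge_sup; first exact: (hsup n w).1.
  by move=> _ [m /= nm <-]; exact: hc.
have mS n : cmeasurable (fun w => (S n w)%:C%C : C).
  split; last exact: measurable_cst.
  by apply: measurable_fun_sups => // w _; exact: hub.
pose Y n := L0_of mu (CMfun (mS n)).
have YE n : \forall w \ae mu, Y n w = (S n w)%:C%C := L0_ofE mu (CMfun (mS n)).
have [_ _ _ z0 _] := L0_ringE (0 : L0 mu) 0.
have fE n : \forall w \ae mu, L0H_norm cmu (x n - l) w = (g n w)%:C%C.
  near=> w; rewrite (near (L0H_normE cmu (x n - l)) w)//.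
  by rewrite (near (L0H_funB (x n) l) w)// rnormE.
exists Y; split.
- move=> n m nm; apply/L0_leP; near=> w.
  rewrite (near (YE n) w)// (near (YE m) w)// lecR.
  by apply: Sle => p mp; apply: leS; exact: leq_trans mp.
- split=> [_ [n _ <-]|z zY].
    apply/L0_leP; near=> w; rewrite (near (YE n) w)// (near z0 w)// ler0c.
    exact: le_trans (h0 n w) (leS _ _ _ (leqnn n)).
  have zYE n : \forall w \ae mu, (z : L0 mu) w <= (S n w)%:C%C.
    have /L0_leP zn : z <= Y n by apply: zY; exists n.
    by apply: filterS2 zn (YE n) => w + <-.
  apply/L0_leP; apply: filterS2 z0 (ae_foralln zYE) => w -> zw.
  (* Comparison with [S 0 w] forces [z w] to be real; the tail suprema then bound it by every
     [e > 0]. *)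
  move: (zw 0%N); rewrite !lecE/= => /andP[-> _] /=.
  apply/ler_addgt0Pr => e e0; rewrite add0r.
  have /cvgrPdist_le/(_ e e0)[n _ nP] := hcvg w.
  have := zw n; rewrite lecE/= => /andP[_] /le_trans; apply; apply: Sle => m nm.
  by have := nP m nm; rewrite sub0r normrN; exact: le_trans (ler_norm _).
- move=> n; have [_ _ nY _ _] := L0_ringE (Y n) (Y n).
  rewrite subr0; apply/andP; split; apply/L0_leP; near=> w;
    rewrite ?(near nY w)// (near (YE n) w)// (near (fE n) w)// -(near hE w)//.
    rewrite -rmorphN lecR (@le_trans _ _ 0)// oppr_le0.
    by rewrite (le_trans (h0 n w))// leS.
  by rewrite lecR leS.
Unshelve. all: by end_near. Qed.

End measurable_limits.

(** * From the [L0]-valued operator norm to the fibers *)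

Section contraction.
Context (R : realType) (d : measure_display) (Omega : measurableType d)
  (mu : {finite_measure set Omega -> \bar R}) (cmu : measure_is_complete mu)
  (X : mbundle mu).
Local Notation C := R[i].
Variable T : {linear L0H X -> L0H X}.
Hypothesis T_contr : L0_contraction cmu T.

Lemma contraction_unit (x : L0H X) :
  L0H_norm cmu x <= 1 -> L0H_norm cmu (T x) <= 1.
Proof.
move=> x1; have [_ [N [ubN _] N1]] := T_contr; apply: le_trans N1.
by apply: ubN; exists x.
Qed.

(* [x = |x| (|x|^-1 x)], where the junk value [0^-1 = 0] is harmless. *)
Lemma contraction_ae (x : L0H X) :
  \forall w \ae mu, `|(T x : L0H X) w| <= `|x w|.
Proof.
have mx := tmeas_norm (mbundleP X) cmu (L0H_tmeas x).
have mi : cmeasurable (fun w => ((rnorm (x w))^-1)%:C%C : C).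
  split; last exact: measurable_cst.
  rewrite (_ : (fun _ => _) = (fun w => powR (rnorm (x w)) (-1))).
    exact: (measurableT_comp (measurable_powR _) mx.1).
  by apply/funext => w; rewrite powR_inv1 ?rnorm_ge0.
pose g := L0_of mu (CMfun mx); pose f := L0_of mu (CMfun mi).
have gE := L0_ofE mu (CMfun mx); have fE := L0_ofE mu (CMfun mi).
have y1 : L0H_norm cmu (f *: x) <= 1.
  have [_ _ _ _ o1] := L0_ringE (1 : L0 mu) 1.
  apply/L0_leP; near=> w.
  rewrite (near (L0H_normE cmu (f *: x)) w)// (near (L0H_funZ f x) w)//.
  rewrite (near fE w)//= (near o1 w)// rnormE lecR.
  rewrite rnormZ ?invr_ge0 ?rnorm_ge0//.
  by have [->|x0] := eqVneq (rnorm (x w)) 0; rewrite ?mulr0// mulVf.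
have xE : x = g *: (f *: x).
  apply: L0HP; near=> w.
  rewrite (near (L0H_funZ g (f *: x)) w)// (near (L0H_funZ f x) w)//.
  rewrite (near fE w)//= (near gE w)//= scalerA.
  have [/eqP|x0] := eqVneq `|x w| 0.
    by rewrite normr_eq0 => /eqP ->; rewrite scaler0.
  have -> : ((rnorm (x w))^-1)%:C%C = `|x w|^-1 :> C by rewrite rnormE fmorphV.
  by rewrite mulfV// scale1r.
have := contraction_unit y1; move=> /L0_leP Ty1.
have [_ _ _ _ o1] := L0_ringE (1 : L0 mu) 1.
near=> w; rewrite {1}xE linearZ/= (near (L0H_funZ g (T (f *: x))) w)//.
rewrite (near gE w)//= normrZ normr_id ler_piMr//.
rewrite -(near (L0H_normE cmu (T (f *: x))) w)//.
by rewrite -[leRHS](near o1 w)//; exact: (near Ty1 w).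
Unshelve. all: by end_near. Qed.

End contraction.

(** * Fiberwise contractions *)

Lemma rat_approx (R : realType) (x : R[i]) (e : R) : 0 < e ->
  exists q : rat * rat, `|x - (ratr q.1 +i* ratr q.2)%C| < e%:C%C.
Proof.
move=> e0; case: x => a b.
have h c : exists q : rat, `|c - ratr q| < e / 2.
  have /rat_in_itvoo[q] : c - e / 2 < c + e / 2 by lra.
  rewrite in_itv/= => /andP[? ?]; exists q.
  by rewrite ltr_norml; apply/andP; split; lra.
have [[p hp] [q hq]] := (h a, h b); exists (p, q) => /=.
have -> : (a +i* b)%C - (ratr p +i* ratr q)%C =
    (a - ratr p)%:C%C + (b - ratr q)%:C%C * 'i%C :> R[i] by simpc.
apply: le_lt_trans (ler_normD _ _) _.
rewrite normrM normCi mulr1 !normc_def/= !expr0n/= !addr0 !sqrtr_sqr.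
by rewrite -rmorphD/= ltcR; lra.
Qed.

(** Rational coefficients within [e / (S + 1)] of the given ones cost at most [e], [S] being the
    total norm of the vectors on both sides. Only countably many conditions remain, so one null set
    can serve them all. *)
Lemma contraction_dense (R : realType) (V : normedModType R[i]) (v : nat -> V) :
  (forall q : seq (rat * rat),
    let c i : R[i] := (ratr (nth 0 q i).1 +i* ratr (nth 0 q i).2)%C in
    `|\sum_(i < size q) c i *: v i.+1| <= `|\sum_(i < size q) c i *: v i|) ->
  forall n (a : nat -> R[i]),
    `|\sum_(i < n) a i *: v i.+1| <= `|\sum_(i < n) a i *: v i|.
Proof.
move=> hq n a; rewrite !rnormE lecR; apply/ler_addgt0Pr => e e0.
pose S := \sum_(i < n) rnorm (v i.+1) + \sum_(i < n) rnorm (v i).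
have S0 : 0 <= S by rewrite addr_ge0// sumr_ge0// => i _; exact: rnorm_ge0.
have S1 : 0 < S + 1 by rewrite ltr_wpDl.
have e1 : 0 < e / (S + 1) by rewrite divr_gt0.
have /choice[q qP] i := rat_approx (a i) e1.
pose c i : R[i] := (ratr (q i).1 +i* ratr (q i).2)%C.
have diff (x : nat -> V) :
    rnorm (\sum_(i < n) a i *: x i - \sum_(i < n) c i *: x i) <=
    e / (S + 1) * \sum_(i < n) rnorm (x i).
  rewrite -lecR -rnormE -sumrB rmorphM/= rmorph_sum mulr_sumr.
  apply: le_trans (ler_norm_sum _ _ _) _; apply: ler_sum => i _.
  by rewrite -scalerBl normrZ rnormE ler_wpM2r ?ler0c ?rnorm_ge0// ltW// qP.
have := hq (mkseq q n); rewrite size_mkseq => /=.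
under eq_bigr => i _ do rewrite (nth_mkseq _ _ (ltn_ord i)).
under [X in _ <= `|X| -> _]eq_bigr => i _ do
  rewrite (nth_mkseq _ _ (ltn_ord i)).
rewrite !rnormE lecR -/(c _) => hc.
set A := \sum_(i < n) _; set B := \sum_(i < n) a _ *: v _.
have h1 := diff (fun i => v i.+1); have h2 := diff v.
set A' := \sum_(i < n) c i *: v i.+1 in h1 hc *.
have := ler_rnormD (A - A') A'; rewrite subrK => h3.
have := ler_rnormD (\sum_(i < n) c i *: v i - B) B; rewrite subrK => h4.
rewrite -[rnorm (_ - B)]rnormN opprB in h4.
have h5 : e / (S + 1) * S <= e.
  by rewrite -mulrA ler_piMr ?(ltW e0)// mulrC ler_pdivrMr// mul1r; lra.
rewrite /S mulrDr in h5.
apply: (le_trans h3); apply: le_trans (lerD h1 hc) _.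
apply: (le_trans (lerD (lexx _) h4)).
apply: le_trans (lerD (lexx _) (lerD h2 (lexx _))) _.
by rewrite addrA addrC lerD2l.
Qed.

Section orbit.
Context (R : realType) (d : measure_display) (Omega : measurableType d)
  (mu : {finite_measure set Omega -> \bar R}) (cmu : measure_is_complete mu)
  (X : mbundle mu).
Local Notation C := R[i].
Variable T : {linear L0H X -> L0H X}.
Hypothesis T_contr : L0_contraction cmu T.

(** For fixed rational coefficients the sum is the value of an element of [L0H X], to which
    [contraction_ae] applies; countably many null sets are then united. *)
Lemma orbit_contraction (u : L0H X) : \forall w \ae mu, forall n (a : nat -> C),
  `|\sum_(i < n) a i *: (iter i.+1 T u : L0H X) w| <=
  `|\sum_(i < n) a i *: (iter i T u : L0H X) w|.
Proof.
pose c (q : seq (rat * rat)) i : C :=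
  (ratr (nth 0 q i).1 +i* ratr (nth 0 q i).2)%C.
pose y q j : L0H X :=
  \sum_(0 <= i < size q) L0_cst mu (c q i) *: iter (j + i) T u.
have yE q j : \forall w \ae mu,
    y q j w = \sum_(i < size q) c q i *: (iter (j + i) T u : L0H X) w.
  have h1 := L0H_fun_sum (index_iota 0 (size q))
    (fun i => L0_cst mu (c q i) *: (iter (j + i) T u : L0H X)).
  have h2 := ae_foralln (fun i =>
    L0H_funZ (L0_cst mu (c q i)) (iter (j + i) T u : L0H X)).
  have h3 := ae_foralln (fun i => L0_cstE mu (c q i)).
  apply: filterS3 h1 h2 h3 => w -> h2 h3.
  by rewrite big_mkord; apply: eq_bigr => i _; rewrite h2 h3.
have hq q : \forall w \ae mu,
    `|\sum_(i < size q) c q i *: (iter i.+1 T u : L0H X) w| <=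
    `|\sum_(i < size q) c q i *: (iter i T u : L0H X) w|.
  have Ty : T (y q 0%N) = y q 1%N.
    by rewrite linear_sum; apply: eq_bigr => i _; rewrite linearZ.
  have := contraction_ae T_contr (y q 0%N); rewrite Ty => h.
  by apply: filterS3 h (yE q 0%N) (yE q 1%N) => w hw h0 h1; rewrite -h0 -h1.
(* [unpickle] turns the quantifier over [q] into one over [nat], the form [ae_foralln] accepts. *)
have : \forall w \ae mu, forall m, forall q, unpickle m = Some q ->
    `|\sum_(i < size q) c q i *: (iter i.+1 T u : L0H X) w| <=
    `|\sum_(i < size q) c q i *: (iter i T u : L0H X) w|.
  apply: ae_foralln => m; case: (unpickle m) => [q|]; last exact: aeW.
  by apply: filterS (hq q) => w h _ [<-].
apply: filterS => w h.
apply: (@contraction_dense _ _ (fun i => (iter i T u : L0H X) w)) => q.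
by apply: (h (pickle q)); rewrite pickleK.
Qed.

Lemma subseq_avgE k u n : \forall w \ae mu,
  subseq_avg k T u n w = avg k (fun i => (iter i T u : L0H X) w) n.
Proof.
have h1 := L0H_fun_sum (index_iota 1 n.+1) (fun j => iter (k j) T u : L0H X).
have h2 := L0H_funZ (L0_cst mu n%:R^-1)
  (\sum_(1 <= j < n.+1) iter (k j) T u : L0H X).
apply: filterS3 h1 h2 (L0_cstE mu n%:R^-1) => w {}h1 {}h2 h3.
by rewrite /subseq_avg h2 h1 h3.
Qed.

End orbit.

(** * Gluing the fiberwise limits into a measurable section *)

Theorem theorem4p3 (R : realType) (d : measure_display)
    (Omega : measurableType d) (mu : {finite_measure set Omega -> \bar R})
    (cmu : measure_is_complete mu) (X : mbundle mu) (k : nat -> nat)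
    (k_gt0 : forall j, (1 <= j)%N -> (0 < k j)%N)
    (k_incr : forall i j, (1 <= i)%N -> (i < j)%N -> (k i < k j)%N)
    (k_avg : forall l : R[i], `|l| = 1 -> l != 1 ->
      (fun n : nat => n%:R^-1 * \sum_(1 <= j < n.+1) l ^+ k j : R[i]^o) @ \oo
        --> (0 : R[i]^o))
    (T : {linear L0H X -> L0H X}) (T_contr : L0_contraction cmu T) :
  forall u : L0H X, L0H_cvg cmu (subseq_avg k T u).
Proof.
move=> u; pose v w i := (iter i T u : L0H X) w.
(* Where the averages diverge [lim] is a default value; this happens on a null set only, so
   [tmeas_cvg] still makes [l] measurable. *)
pose l w := lim (avg k (v w) n @[n --> \oo]).
have avgl : \forall w \ae mu, subseq_avg k T u n w @[n --> \oo] --> l w.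
  have h1 := orbit_contraction T_contr u.
  have h2 := ae_foralln (subseq_avgE T k u).
  apply: filterS2 h1 h2 => w h1 h2; under eq_fun do rewrite h2.
  exact: (mean_ergodic_cvg h1 k_avg).
have ml : tmeas (csections X) l.
  by apply: (tmeas_cvg cmu _ avgl) => n; exact: L0H_tmeas.
exists (L0H_of (MSection (tsection_meas ml))); apply: L0H_ocvg.
by apply: filterS2 avgl (L0H_ofmE ml) => w + ->.
Qed.
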